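(* Let $X$ be an irreducible affine variety over $k$ and let $G$ be a commutative unipotent subgroup of $\mathrm{Aut}(X)$. Then the following statements are equivalent: (a) $G$ is maximal among commutative subgroups of $\mathrm{Aut}(X)$; (b) $G$ is maximal among commutative unipotent subgroups of $\mathrm{Aut}(X)$; (c) $G = \mathrm{R}_X(U)$ for some commutative unipotent algebraic subgroup $U \subseteq \mathrm{Aut}(X)$.
   Context: $k$ is an algebraically closed field of characteristic zero; varieties are over $k$ and algebraic groups are linear. For an affine variety $X$, $\mathrm{Aut}(X)$ carries its natural ind-group structure: after a closed embedding $X \subseteq \mathbb{A}^n$, let $\mathrm{Aut}(X)_d$ be the set of $\varphi \in \mathrm{Aut}(X)$ such that $\varphi$ and $\varphi^{-1}$ are given by polynomials of degree $\le d$; via $\varphi \mapsto (\varphi,\varphi^{-1})$ this is a closed subvariety of a finite-dimensional vector space, and a subset of $\mathrm{Aut}(X)$ is closed iff its intersection with each $\mathrm{Aut}(X)_d$ is closed (the topology does not depend on the embedding). An algebraic subgroup of $\mathrm{Aut}(X)$ is the image of an algebraic group under the homomorphism to $\mathrm{Aut}(X)$ induced by an algebraic action on $X$. An element of $\mathrm{Aut}(X)$ is unipotent if it lies in the image of the homomorphism $\mathbb{G}_a \to \mathrm{Aut}(X)$ induced by some algebraic $\mathbb{G}_a$-action on $X$. A subgroup of $\mathrm{Aut}(X)$ is unipotent if it is closed and consists only of unipotent elements. Let $U \subseteq \mathrm{Aut}(X)$ be a unipotent algebraic subgroup, $u \in U \setminus \{\mathrm{id}_X\}$, and let $\rho \colon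 \mathbb{G}_a \times X \to X$ be a $\mathbb{G}_a$-action with $\rho(1,x) = u(x)$ for all $x \in X$. For a $U$-invariant rational function $f \in k(X)^U$ with domain $\mathrm{dom}(f) \subseteq X$, the map $x \mapsto \rho(f(x),x)$ is an automorphism of $\mathrm{dom}(f)$; the resulting element of the group $\mathrm{Bir}(X)$ of birational transformations of $X$ is denoted $f\cdot u$. For $u = \mathrm{id}_X$ one puts $f \cdot u = \mathrm{id}_X$. Put $\mathrm{rRepl}_X(U) = \{ f\cdot u \in \mathrm{Bir}(X) \mid f \in k(X)^U,\ u \in U\}$ and $\mathrm{R}_X(U) = \mathrm{Aut}(X) \cap \langle \mathrm{rRepl}_X(U)\rangle$, where $\langle\cdot\rangle$ is the generated subgroup in $\mathrm{Bir}(X)$.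
   Formalization: The group G is assumed nontrivial: for G = {id} the equivalence fails, e.g. on the affine line, where {id} = R_X({id}) satisfies (c) but lies properly in the group of translations, so (a) and (b) fail. *)

(* Defs.v *)
From mathcomp Require Import all_boot all_order all_algebra.
From mathcomp Require Import mpoly.
From mathcomp Require Import boolp classical_sets.

Set Implicit Arguments.
Unset Strict Implicit.
Unset Printing Implicit Defensive.

Import GRing.Theory.
Local Open Scope ring_scope.
Local Open Scope classical_set_scope.

Section AffineVarieties.
Context {k : closedFieldType}.

Definition zeros n (S : set {mpoly k[n]}) : set 'rV[k]_n :=
  [set x | forall p, S p -> p.@[x 0] = 0].

Definition zclosed n (Z : set 'rV[k]_n) : Prop := exists S, Z = zeros S.

Definition irreducible n (X : set 'rV[k]_n) : Prop :=
  X !=set0 /\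
  forall A B, zclosed A -> zclosed B -> X `<=` A `|` B -> X `<=` A \/ X `<=` B.

Definition poly_map m n (P : 'I_n -> {mpoly k[m]}) (x : 'rV[k]_m) : 'rV[k]_n :=
  \row_i (P i).@[x 0].

(* Polynomial tuples represent maps of affine varieties only up to the
   vanishing ideal of the source. *)
Definition represents m n (X : set 'rV[k]_m) (Y : set 'rV[k]_n)
    (P : 'I_n -> {mpoly k[m]}) (f : X -> Y) : Prop :=
  forall x, val (f x) = poly_map P (val x).

Definition morphism m n (X : set 'rV[k]_m) (Y : set 'rV[k]_n) (f : X -> Y) :
  Prop := exists P, represents P f.

(* Morphisms X * Y -> Z, with X * Y embedded in affine (m + n)-space. *)
Definition morphism2 m n l (X : set 'rV[k]_m) (Y : set 'rV[k]_n)
    (Z : set 'rV[k]_l) (f : X -> Y -> Z) : Prop :=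
  exists P : 'I_l -> {mpoly k[m + n]},
    forall x y, val (f x y) = poly_map P (row_mx (val x) (val y)).

Record alg_group := AlgGroup {
  ag_dim : nat;
  ag_set :> set 'rV[k]_ag_dim;
  ag_closed : zclosed ag_set;
  ag_one : ag_set;
  ag_mul : ag_set -> ag_set -> ag_set;
  ag_inv : ag_set -> ag_set;
  ag_mul_morphism : morphism2 ag_mul;
  ag_inv_morphism : morphism ag_inv;
  ag_mulA : associative ag_mul;
  ag_mul1 : left_id ag_one ag_mul;
  ag_mulV : left_inverse ag_one ag_inv ag_mul }.

Section Aut.
Context {n : nat} {X : set 'rV[k]_n}.

Definition Aut : set (X -> X) :=
  [set f | morphism f /\ exists g : X -> X, [/\ morphism g, cancel f g & cancel g f]].

Definition aut_subgroup (G : set (X -> X)) : Prop :=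
  [/\ G `<=` Aut, G id, forall f g, G f -> G g -> G (f \o g) &
      forall f g, G f -> cancel f g -> cancel g f -> G g].

Definition commutative_set (G : set (X -> X)) : Prop :=
  forall f g, G f -> G g -> f \o g = g \o f.

Definition alg_action (H : alg_group) (rho : H -> X -> X) : Prop :=
  [/\ morphism2 rho, rho (ag_one H) = id &
      forall g h, rho (ag_mul g h) = rho g \o rho h].

Definition alg_subgroup (U : set (X -> X)) : Prop :=
  exists (H : alg_group) (rho : H -> X -> X), alg_action rho /\ U = range rho.

(* The action map is polynomial on the product of the affine line and X. *)
Definition Ga_action (rho : k -> X -> X) : Prop :=
  [/\ exists P : 'I_n -> {mpoly k[1 + n]},
        forall s x, val (rho s x) = poly_map P (row_mx s%:M (val x)),
      rho 0 = id &
      forall s t, rho (s + t) = rho s \o rho t].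

Definition unipotent_elt (u : X -> X) : Prop :=
  exists rho s, Ga_action rho /\ u = rho s.

(* c is the list of coefficients of an n-tuple of polynomials of degree <= d
   in n variables. *)
Definition coef_dim d : nat := #|{: 'I_n * 'X_{1..n < d.+1}}|.

Definition poly_of_coef d (c : 'rV[k]_(coef_dim d)) (i : 'I_n) : {mpoly k[n]} :=
  \sum_(m : 'X_{1..n < d.+1}) c 0 (enum_rank (i, m)) *: 'X_[m].

(* Aut(X)_d lives, via f |-> (f, f^-1), in the space of pairs of n-tuples of
   elements of k[X]_{<= d}, a quotient of the space of pairs of n-tuples of
   polynomials of degree <= d.  A subset of the quotient space is closed iff
   its preimage is, and the latter is the set displayed here. *)
Definition aut_closed (S : set (X -> X)) : Prop :=
  forall d, zclosed [set c : 'rV[k]_(coef_dim d + coef_dim d) |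
    exists f g : X -> X,
      [/\ S f, cancel f g, cancel g f,
          represents (poly_of_coef (lsubmx c)) f &
          represents (poly_of_coef (rsubmx c)) g]].

Definition unipotent_subgroup (G : set (X -> X)) : Prop :=
  [/\ aut_subgroup G, aut_closed G & forall u, G u -> unipotent_elt u].

Definition zopen (D : set X) : Prop :=
  exists2 Z, zclosed Z & D = [set x | ~ Z (val x)].

Definition regular_on (D : set X) (f : X -> k) : Prop :=
  forall x, D x -> exists (V : set X) (p q : {mpoly k[n]}),
    [/\ zopen V, V x, V `<=` D &
        forall y, V y ->
          q.@[val y 0] != 0 /\ f y = p.@[val y 0] / q.@[val y 0]].

(* Partial maps on X are encoded as total functions whose values outside some
   nonempty open set are irrelevant; [geneq] is equality of the rational maps
   they define (X being irreducible, nonempty open sets are dense). *)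
Definition geneq T (f g : X -> T) : Prop :=
  exists D, [/\ zopen D, D !=set0 & forall x, D x -> f x = g x].

(* Elements of k(X), up to [geneq]. *)
Definition rational_fun (f : X -> k) : Prop :=
  exists D, [/\ zopen D, D !=set0 & regular_on D f].

Definition regular_map_on (D : set X) (f : X -> X) : Prop :=
  forall i, regular_on D (fun x => val (f x) 0 i).

(* f restricts to an isomorphism between nonempty open subsets of X.  Bir(X) is
   the group of such f up to [geneq]; its law is induced by the composition of
   functions, and Aut is contained in birational. *)
Definition birational : set (X -> X) :=
  [set f | exists (D E : set X) (g : X -> X),
    [/\ zopen D /\ D !=set0, zopen E /\ E !=set0,
        (forall x, D x -> E (f x) /\ g (f x) = x),
        (forall y, E y -> D (g y) /\ f (g y) = y) &
        regular_map_on D f /\ regular_map_on E g]].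

(* Subgroups of Bir(X), as [geneq]-saturated subsets of birational. *)
Definition bir_subgroup (H : set (X -> X)) : Prop :=
  [/\ H `<=` birational,
      forall f g, H f -> geneq f g -> H g,
      H id,
      forall f g, H f -> H g -> H (f \o g) &
      forall f g, H f -> birational g ->
        geneq (f \o g) id -> geneq (g \o f) id -> H g].

Definition bir_generated (S : set (X -> X)) : set (X -> X) :=
  smallest bir_subgroup S.

(* k(X)^U *)
Definition invariant_fun (U : set (X -> X)) (f : X -> k) : Prop :=
  rational_fun f /\ forall u, U u -> geneq (f \o u) f.

(* h represents f . u in Bir(X).  Since f . u is an element of Bir(X), the
   formula x |-> rho (f x) x only needs to hold generically. *)
Definition is_replica (f : X -> k) (u h : X -> X) : Prop :=
  (u = id /\ geneq h id) \/
  (u <> id /\ exists rho, [/\ Ga_action rho, rho 1 = u &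
                              geneq h (fun x => rho (f x) x)]).

Definition rRepl (U : set (X -> X)) : set (X -> X) :=
  [set h | exists f u, [/\ invariant_fun U f, U u & is_replica f u h]].

(* The identity has only itself as a replica, so RX [set id] = [set id], which
   need not be maximal among commutative (unipotent) subgroups: on the affine
   line it is contained in the group of translations. *)
Definition RX (U : set (X -> X)) : set (X -> X) :=
  Aut `&` bir_generated (rRepl U).

End Aut.

Arguments Aut {n} X.

End AffineVarieties.

Definition maximal_among T (C : set (set T)) (G : set T) : Prop :=
  C G /\ forall H, C H -> G `<=` H -> H = G.

(* Main.v *)
Require Import Defs.
From HB Require Import structures.
From mathcomp Require Import all_boot all_order all_algebra.
From mathcomp Require Import boolp classical_sets.
From mathcomp Require Import mpoly ring.

(**
Let B = k[X]. A Ga-action rho on X corresponds to the locally nilpotent derivation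
gen(rho) sending b to the linear coefficient of s |-> b(rho(s, x)). Let U be a
commutative unipotent subgroup. A closed subgroup containing an element u lying on a
Ga-action contains that whole action, so U is a union of commuting one-parameter
groups, finitely many of which already have joint kernel B^U. Maximal nonzero minors
provide such derivations D_j together with "slices" s_j in B and a nonzero q in B^U
such that D_i(s_j) = q if i = j and 0 otherwise; every derivation E that commutes with
the one-parameter groups of U and kills B^U then satisfies q E = sum_j E(s_j) D_j.

Let C(U) be the group of automorphisms that commute with U and fix B^U pointwise. For
h in C(U) the operator h^* - 1 is nilpotent on each element of B, so m |-> h^m
interpolates to a Ga-action; together with the formula for q E this makes C(U)
commutative and unipotent, and it is closed because its defining conditions are
polynomial. The formula also expresses h generically as a product of replicas,
whence C(U) is contained in R_X(U); conversely the birational maps that generically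
commute with U and fix B^U form a group containing all replicas, so R_X(U) = C(U).

(a) => (b) is immediate. (b) => (c): for U the vector group spanned by the D_j
obtained from G one has G <= C(U) = R_X(U), with equality by maximality.
(c) => (a): an automorphism commuting with C(U) commutes with the replicas f.u for f in
B^U and u in U, hence fixes f, and so lies in C(U).
*)

Set Implicit Arguments.
Unset Strict Implicit.
Unset Printing Implicit Defensive.

Import GRing.Theory.
Local Open Scope ring_scope.

(** * Commuting locally nilpotent derivations *)

Section CommutingDerivations.
Context {B : comPzRingType}.
Hypothesis B_nontrivial : 1 != 0 :> B.
Hypothesis B_integral : forall a b : B, a * b = 0 -> a = 0 \/ b = 0.
Hypothesis B_torsion_free : forall (a : B) d, a *+ d.+1 = 0 -> a = 0.

(** * Minors over an integral domain *)

Lemma cancel_nonzero (q a : B) : q != 0 -> q * a = 0 -> a = 0.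
Proof. by move=> /eqP q0 /B_integral[]. Qed.

Lemma expr_nonzero (q : B) m : q != 0 -> q ^+ m != 0.
Proof.
move=> q0; elim: m => [|m IH]; first by rewrite expr0 B_nontrivial.
by apply/eqP; rewrite exprS => /(cancel_nonzero q0); apply/eqP.
Qed.

(** Here [f] is a matrix whose index types may be infinite. Repetitions in [I] or [J] are allowed;
    they only make the determinant vanish. *)
Definition minor (R C : Type) (f : R -> C -> B) r (I : 'I_r -> R)
  (J : 'I_r -> C) : 'M[B]_r := \matrix_(i, j) f (I i) (J j).

(** A Schur complement without division: the left factor in the proof makes the bordered matrix
    block triangular, with diagonal blocks [(\det M)%:M] and the difference of the two sides, and
    [B] is a domain. *)
Lemma bordered_det r (M : 'M[B]_r) (u : 'cV_r) (v : 'rV_r) (w : 'M_1) :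
  \det M != 0 -> \det (block_mx M u v w) = 0 ->
  \det M *: w = v *m \adj M *m u.
Proof.
move=> M0 N0.
have : \det (block_mx (\adj M) 0 (- (v *m \adj M)) (\det M)%:M
   *m block_mx M u v w) = 0 by rewrite det_mulmx N0 mulr0.
rewrite mulmx_block !mul0mx !addr0 mul_adj_mx !mul_scalar_mx !mulNmx.
rewrite -[v *m _ *m M]mulmxA mul_adj_mx mul_mx_scalar addNr det_ublock det_scalar.
move=> /(cancel_nonzero (expr_nonzero _ M0)).
rewrite {1}[- _ + _]mx11_scalar det_scalar expr1 => e.
apply/eqP; rewrite -subr_eq0 addrC.
by rewrite [X in X == 0]mx11_scalar e raddf0.
Qed.

(** Cramer's rule: bordering a nonzero minor of maximal size by row [i] and column [c] gives
    determinant zero. The coefficients depend on [i] alone, so this is a relation between whole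
    rows. *)
Lemma maximal_minor (R C : Type) (f : R -> C -> B) n :
  (forall r (I : 'I_r -> R) (J : 'I_r -> C),
    \det (minor f I J) != 0 -> (r <= n)%N) ->
  exists r (I : 'I_r -> R) (J : 'I_r -> C), \det (minor f I J) != 0 /\
    forall i c, \det (minor f I J) * f i c =
      \sum_a (\sum_b f i (J b) * \adj (minor f I J) b a) * f (I a) c.
Proof.
move=> bound.
pose P r := `[< exists (I : 'I_r -> R) (J : 'I_r -> C),
  \det (minor f I J) != 0 >].
(* The empty minor has determinant 1. *)
have exP : exists r, P r.
  exists 0%N; apply/asboolP.
  have F T : 'I_0 -> T by case.
  by exists (F R), (F C); rewrite det_mx00 B_nontrivial.
have ubP r : P r -> (r <= n)%N by move=> /asboolP[I [J]]; apply: bound.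
case: (ex_maxnP exP ubP) => r /asboolP[I [J q0]] rmax.
exists r, I, J; split=> // i c.
pose I' (x : 'I_(r + 1)) := match split x with inl a => I a | inr _ => i end.
pose J' (x : 'I_(r + 1)) := match split x with inl a => J a | inr _ => c end.
have I'l a : I' (lshift 1 a) = I a.
  by rewrite /I' (unsplitK (inl a : 'I_r + 'I_1)).
have I'r a : I' (rshift r a) = i.
  by rewrite /I' (unsplitK (inr a : 'I_r + 'I_1)).
have J'l a : J' (lshift 1 a) = J a.
  by rewrite /J' (unsplitK (inl a : 'I_r + 'I_1)).
have J'r a : J' (rshift r a) = c.
  by rewrite /J' (unsplitK (inr a : 'I_r + 'I_1)).
have d0 : \det (minor f I' J') = 0.
  apply/eqP/negPn/negP => d0.
  have /rmax : P (r + 1)%N by apply/asboolP; exists I', J'.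
  by rewrite addn1 ltnn.
have := @bordered_det r (minor f I J) (\col_a f (I a) c) (\row_b f i (J b))
  (const_mx (f i c)) q0.
have -> : block_mx (minor f I J) (\col_a f (I a) c) (\row_b f i (J b))
  (const_mx (f i c)) = minor f I' J'.
  apply/matrixP => x y; rewrite -(splitK x) -(splitK y).
  case: (split x) => a; case: (split y) => b /=.
  - by rewrite block_mxEul !mxE I'l J'l.
  - by rewrite block_mxEur !mxE I'l J'r.
  - by rewrite block_mxEdl !mxE I'r J'l.
  - by rewrite block_mxEdr !mxE I'r J'r.
move=> /(_ d0) /matrixP /(_ 0 0); rewrite !mxE => ->.
by apply: eq_bigr => a _; rewrite !mxE; congr (_ * _);
  apply: eq_bigr => b _; rewrite !mxE.
Qed.

(** * Commuting derivations and slices *)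

Definition derivation (D : B -> B) : Prop :=
  (forall a b, D (a + b) = D a + D b) /\
  (forall a b, D (a * b) = D a * b + a * D b).

Section DerivationTheory.
Variables (D : B -> B) (derD : derivation D).

Lemma der0 : D 0 = 0.
Proof. by apply: (@addIr _ (D 0)); rewrite -derD.1 !add0r. Qed.

Lemma derN a : D (- a) = - D a.
Proof. by apply: (@addIr _ (D a)); rewrite -derD.1 !addNr der0. Qed.

Lemma derB a b : D (a - b) = D a - D b.
Proof. by rewrite derD.1 derN. Qed.

Lemma der_sum (I : Type) (s : seq I) (P : pred I) (F : I -> B) :
  D (\sum_(i <- s | P i) F i) = \sum_(i <- s | P i) D (F i).
Proof. by apply: big_morph; [exact: derD.1 | exact: der0]. Qed.

Lemma derMn a m : D (a *+ m) = D a *+ m.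
Proof.
by elim: m => [|m IH]; rewrite ?mulr0n ?der0 // !mulrS derD.1 IH.
Qed.

Lemma derMc c a : D c = 0 -> D (c * a) = c * D a.
Proof. by move=> c0; rewrite derD.2 c0 mul0r add0r. Qed.

Lemma derMcr c a : D c = 0 -> D (a * c) = D a * c.
Proof. by move=> c0; rewrite derD.2 c0 mulr0 addr0. Qed.

Lemma der1 : D 1 = 0.
Proof.
have := derD.2 1 1; rewrite mulr1 mulr1 mul1r => e.
by apply: (@addIr _ (D 1)); rewrite add0r -e.
Qed.

End DerivationTheory.

Section Filtration.
Variables (r : nat) (D : 'I_r -> B -> B).
Hypothesis derD : forall i, derivation (D i).
Hypothesis comD : forall i j a, D i (D j a) = D j (D i a).
Hypothesis nilD : forall i a, exists m, iter m (D i) a = 0.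

(** A joint nilpotency filtration: step 1 is the ring of constants, and step 2 consists of the
    elements all of whose derivatives are constant. *)
Fixpoint filt d (a : B) : Prop :=
  if d is d'.+1 then forall i, filt d' (D i a) else a = 0.

Lemma filt0 d : filt d 0.
Proof. by elim: d => //= d IH i; rewrite der0. Qed.

Lemma filtS d a : filt d a -> filt d.+1 a.
Proof.
elim: d a => [|d IH] a aF i; last exact/IH/aF.
by rewrite (aF : a = 0) der0.
Qed.

Lemma filt_le d e a : (d <= e)%N -> filt d a -> filt e a.
Proof. by move=> /subnK <-; elim: (e - d)%N => //= m IH /IH/filtS. Qed.

Lemma filtD d a b : filt d a -> filt d b -> filt d (a + b).
Proof.
elim: d a b => [|d IH] a b aF bF; first by rewrite (aF : a = 0) (bF : b = 0) addr0.
by move=> i; rewrite (derD i).1; apply: IH.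
Qed.

Lemma filtN d a : filt d a -> filt d (- a).
Proof.
elim: d a => [|d IH] a aF; first by rewrite (aF : a = 0) oppr0.
by move=> i; rewrite derN //; apply: IH.
Qed.

Lemma filtB d a b : filt d a -> filt d b -> filt d (a - b).
Proof. by move=> aF /filtN; apply: filtD. Qed.

(** Since the [D i] commute, a word longer than the sum of the nilpotency orders [m i] contains some
    [D i] at least [m i] times. The induction spends one unit of [m i] on each letter [D i]. *)
Lemma filt_exhausts a : exists d, filt d a.
Proof.
have main M (m : 'I_r -> nat) (b : B) : (\sum_i m i <= M)%N ->
    (forall i, iter (m i) (D i) b = 0) -> filt M.+1 b.
  elim: M m b => [|M IH] m b mM bm i.
    have := bm i.
    suff -> : m i = 0%N by move=> /= ->; rewrite der0.
    by apply/eqP; rewrite -leqn0 (leq_trans _ mM) // (bigD1 i) // leq_addr.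
  case mi: (m i) (bm i) => [|l] bl.
    by have -> : b = 0 by []; rewrite der0 //; exact: (filt0 M.+1).
  apply: (IH (fun j => if j == i then l else m j)) => [|j].
    rewrite -ltnS (leq_trans _ mM) // (bigD1 i) //= [X in (_ <= X)%N](bigD1 i) //=.
    rewrite eqxx mi -addSn leq_add2l leq_sum // => j /negPf -> //.
  case: eqP => [->|_]; first by rewrite -iterSr.
  have -> : forall p, iter p (D j) (D i b) = D i (iter p (D j) b).
    by elim=> //= p ->; rewrite comD.
  by rewrite bm der0.
have [m am] := choice (fun i => nilD i a).
by exists (\sum_i m i).+1; apply: main am.
Qed.

Definition const (a : B) : Prop := forall i, D i a = 0.

Lemma const_mul a b : const a -> const b -> const (a * b).
Proof. by move=> ca cb i; rewrite (derMc (derD i)) // cb mulr0. Qed.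

Lemma const_opp a : const a -> const (- a).
Proof. by move=> ca i; rewrite derN // ca oppr0. Qed.

Lemma const_sum (I : Type) (s : seq I) (F : I -> B) :
  (forall i, const (F i)) -> const (\sum_(i <- s) F i).
Proof. by move=> cF i; rewrite der_sum // big1 // => x _; apply: cF. Qed.

Lemma const_prod (I : Type) (s : seq I) (F : I -> B) :
  (forall i, const (F i)) -> const (\prod_(i <- s) F i).
Proof.
by move=> cF; apply: big_ind => //; [move=> i; exact: der1 | exact: const_mul].
Qed.

Lemma const_det m (M : 'M[B]_m) : (forall i j, const (M i j)) -> const (\det M).
Proof.
move=> cM; apply: const_sum => s; apply: const_mul; last exact: const_prod.
elim: (perm.odd_perm s : nat) => [|e IH]; first by move=> i; rewrite expr0; apply: der1.
by rewrite exprS mulN1r; apply: const_opp.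
Qed.

Lemma const_adj m (M : 'M[B]_m) :
  (forall i j, const (M i j)) -> forall i j, const ((\adj M) i j).
Proof.
move=> cM i j; rewrite mxE /cofactor; apply: const_mul.
  elim: (_ + _)%N => [|e IH]; first by move=> l; rewrite expr0; apply: der1.
  by rewrite exprS mulN1r; apply: const_opp.
by apply: const_det => l l'; rewrite !mxE.
Qed.

(** The matrix [D i t], with [t] in step 2 of the filtration, has constant entries. The adjugate of
    a maximal nonzero minor combines the chosen [t] into slices, turning the minor into [q] times
    the identity. The error term [E' E] of the formula for [E] then vanishes by induction along the
    filtration. *)
Theorem slices : exists m (I : 'I_m -> 'I_r) (s : 'I_m -> B) (q : B),
  [/\ q != 0, const q, forall i j, D (I i) (s j) = q *+ (i == j),
    forall i j, const (D i (s j)) &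
    forall E, derivation E -> (forall i a, E (D i a) = D i (E a)) ->
      (forall a, const a -> E a = 0) ->
      forall a, q * E a = \sum_j E (s j) * D (I j) a].
Proof.
pose f (i : 'I_r) (t : {t : B | filt 2 t}) := D i (sval t).
have fc i t : const (f i t) by move=> j; apply: (svalP t).
(* There are only [r] rows, and a minor with a repeated row vanishes. *)
have [] := @maximal_minor _ _ f r.
  move=> m I J; rewrite leqNgt; apply: contraNN => rm; apply/eqP.
  have /injectivePn[i [i' ii' Iii']] : ~~ injectiveb I.
    by apply/injectiveP => /leq_card; rewrite !card_ord leqNgt rm.
  by apply: (determinant_alternate ii') => j; rewrite !mxE Iii'.
move=> m [I [J [q0 qf]]]; set M := minor f I J in q0 qf; set q := \det M.
pose t j := sval (J j).
pose s j := \sum_l t l * \adj M l j.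
have cM i j : const (M i j) by rewrite mxE; apply: fc.
have cq : const q by apply: const_det.
have cadj i j : const (\adj M i j) by apply: const_adj.
have Ds i j : D i (s j) = \sum_l D i (t l) * \adj M l j.
  rewrite (der_sum (derD i)); apply: eq_bigr => l _.
  by apply: (derMcr (derD i)); apply: cadj.
have DIs i j : D (I i) (s j) = q *+ (i == j).
  have -> : q *+ (i == j) = (M *m \adj M) i j by rewrite mul_mx_adj mxE.
  by rewrite Ds mxE; apply: eq_bigr => l _; rewrite [M i l]mxE.
have cDs i j : const (D i (s j)).
  by rewrite Ds; apply: const_sum => l; apply: const_mul => //; have := fc i (J l).
exists m, I, s, q; split=> //.
pose E' E a := q * E a - \sum_j E (s j) * D (I j) a.
(* [q a - sum_j (D_j a) s_j] is constant for [a] in the second filtration step,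
   by maximality of the minor. *)
have E'2 E : derivation E -> (forall a, const a -> E a = 0) ->
    forall a, filt 2 a -> E' E a = 0.
  move=> derE E0 a aF.
  have /E0 : const (q * a - \sum_j D (I j) a * s j).
    move=> i; rewrite derB // (derMc (derD i)) // der_sum //.
    have := qf i (exist _ a aF); rewrite /f /= -/q => ->.
    apply/eqP; rewrite subr_eq0; apply/eqP; apply: eq_bigr => j _.
    by rewrite (derMc (derD i)) ?Ds 1?mulrC //; apply: aF.
  rewrite (derB derE) (derMc derE _ (E0 _ cq)) (der_sum derE) => <-.
  congr (_ - _); apply: eq_bigr => j _.
  by rewrite (derMc derE) 1?mulrC //; apply: E0 => i; apply: aF.
have E'C E : derivation E -> (forall i a, E (D i a) = D i (E a)) ->
   (forall a, const a -> E a = 0) -> forall i a, D i (E' E a) = E' E (D i a).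
  move=> derE comE E0 i a; rewrite /E' derB // (derMc (derD i)) // comE.
  rewrite der_sum //; congr (_ - _); apply: eq_bigr => j _.
  by rewrite (derMc (derD i)) 1?comD // -comE E0.
(* Being zero on step 2 and commuting with every [D i], the operator [E' E] lowers the filtration by
   two. *)
have E'F E : derivation E -> (forall i a, E (D i a) = D i (E a)) ->
   (forall a, const a -> E a = 0) -> forall d a, filt d.+1 a -> filt d.-1 (E' E a).
  move=> derE comE E0; elim=> [|d IH] a aF.
    by apply: E'2 => //; apply: filtS.
  case: d IH aF => [|d] IH aF; first exact: E'2.
  move=> i; rewrite E'C //; apply: IH; exact: aF.
have DC i a : const a -> D i a = 0 by move=> /(_ i).
(* The Euler operator [sum_j s_j D_j] acts as [d q] on the graded pieces. *)
have euler d a : filt d.+1 a ->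
    filt d (\sum_j s j * D (I j) a - (q * a) *+ d).
  elim: d a => [|d IH] a aF.
    by rewrite mulr0n subr0 /= big1 // => j _; rewrite [D _ _]aF mulr0.
  (* Applying [D i] to the expression for [a] at [d.+1] gives the expression for [D i a] at [d]
     minus [E' (D i) a]; both terms lie in step [d]. *)
  move=> i; have := filtB (IH _ (aF i)) (E'F (D i) (derD i) _ (DC i) _ _ aF).
  move=> /(_ (comD i)) /=.
  congr filt; rewrite (derB (derD i)) (derMn (derD i)) (derMc (derD i) _ (cq i)).
  rewrite (der_sum (derD i)) /E'.
  have -> : \sum_j D i (s j * D (I j) a) =
      \sum_j D i (s j) * D (I j) a + \sum_j s j * D (I j) (D i a).
    by rewrite -big_split; apply: eq_bigr => j _; rewrite (derD i).2 comD.
  by rewrite mulrSr; ring.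
move=> E derE comE E0 a; apply/eqP; rewrite -subr_eq0; apply/eqP.
rewrite -[LHS]/(E' E a).
have [d] := filt_exhausts a; elim: d a => [|d IH] a aF.
  apply: E'2 => //; exact: filt_le aF.
have derE' : derivation (E' E).
  split=> x y; rewrite /E'.
    rewrite derE.1 mulrDr addrACA -opprD -big_split /=.
    by congr (_ - _); apply: eq_bigr => j _; rewrite (derD _).1 mulrDr.
  have -> : \sum_j E (s j) * D (I j) (x * y) =
      (\sum_j E (s j) * D (I j) x) * y + x * \sum_j E (s j) * D (I j) y.
    rewrite mulr_suml mulr_sumr -big_split; apply: eq_bigr => j _ /=.
    by rewrite (derD _).2; ring.
  by rewrite derE.2; ring.
(* Apply the derivation [E' E] to the Euler relation: it kills the [s j], [q] and, by induction, the
   [D (I j) a], so [d] times [q * E' E a] is zero. *)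
have := IH _ (euler _ _ aF); rewrite (derB derE') (derMn derE') (der_sum derE').
rewrite big1 => [|j _]; last first.
  rewrite derE'.2 (IH (D _ a)) // mulr0 addr0.
  suff -> : E' E (s j) = 0 by rewrite mul0r.
  by apply: E'2 => // i; apply: cDs.
have E'q : E' E q = 0 by apply: E'2 => // i i'; rewrite cq der0.
(* For [d = 0] this says nothing, but then [a] lies in step 1, where [E' E] is already known to
   vanish. *)
rewrite sub0r (derMc derE') //; case: d IH aF => [|d] IH aF.
  by move=> _; apply: E'2 => //; apply: filtS.
rewrite -mulrnAr => /eqP; rewrite oppr_eq0 => /eqP.
by move=> /(cancel_nonzero q0) /B_torsion_free.
Qed.

End Filtration.
End CommutingDerivations.

(** * Polynomial functions *)

Section PolynomialFunctions.
Context {k : closedFieldType}.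

Lemma mpoly_ring_ind m (P : {mpoly k[m]} -> Prop) :
  (forall c, P c%:MP) -> (forall i, P 'X_i) ->
  (forall p q, P p -> P q -> P (p + q)) ->
  (forall p q, P p -> P q -> P (p * q)) -> forall p, P p.
Proof.
move=> PC PX PD PM p; rewrite [p]mpolyE.
apply: big_ind => [|p1 p2 P1 P2|mm _]; [by rewrite -mpolyC0|exact: PD|].
rewrite -mul_mpolyC; apply: (PM) => //; rewrite mpolyXE_id.
apply: big_ind => [|p1 p2 P1 P2|i _]; [by rewrite -mpolyC1|exact: PM|].
elim: (mm i) => [|e IH]; first by rewrite expr0 -mpolyC1.
by rewrite exprS; apply: (PM).
Qed.

(** The parameter space [T] is arbitrary and [e] gives its affine coordinates, so the same closure
    lemmas serve [X], [k * X] and spaces of coefficients. *)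
Definition polynomial T m (e : T -> 'rV[k]_m) (F : T -> k) : Prop :=
  exists p : {mpoly k[m]}, forall t, F t = p.@[(e t) 0].

Section Polynomial.
Variables (T : Type) (m : nat) (e : T -> 'rV[k]_m).

Lemma polynomial_ext F G : F =1 G -> polynomial e F -> polynomial e G.
Proof. by move=> FG [p Fp]; exists p => t; rewrite -FG. Qed.

Lemma polynomial_const c : polynomial e (fun=> c).
Proof. by exists c%:MP => t; rewrite mevalC. Qed.

Lemma polynomial_coord i : polynomial e (fun t => e t 0 i).
Proof. by exists 'X_i => t; rewrite mevalXU. Qed.

Lemma polynomial_add F G :
  polynomial e F -> polynomial e G -> polynomial e (fun t => F t + G t).
Proof. by move=> [p Fp] [q Gq]; exists (p + q) => t; rewrite mevalD Fp Gq. Qed.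

Lemma polynomial_opp F : polynomial e F -> polynomial e (fun t => - F t).
Proof. by move=> [p Fp]; exists (- p) => t; rewrite mevalN Fp. Qed.

Lemma polynomial_mul F G :
  polynomial e F -> polynomial e G -> polynomial e (fun t => F t * G t).
Proof. by move=> [p Fp] [q Gq]; exists (p * q) => t; rewrite mevalM Fp Gq. Qed.

Lemma polynomial_sub F G :
  polynomial e F -> polynomial e G -> polynomial e (fun t => F t - G t).
Proof. by move=> pF pG; apply: polynomial_add => //; apply: polynomial_opp. Qed.

Lemma polynomial_exp F j : polynomial e F -> polynomial e (fun t => F t ^+ j).
Proof. by move=> [p Fp]; exists (p ^+ j) => t; rewrite rmorphXn /= Fp. Qed.

Lemma polynomial_sum (I : Type) (s : seq I) (P : pred I) (F : I -> T -> k) :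
  (forall i, polynomial e (F i)) ->
  polynomial e (fun t => \sum_(i <- s | P i) F i t).
Proof.
move=> pF; elim: s => [|i s IH].
  by apply: polynomial_ext (polynomial_const 0) => t; rewrite big_nil.
case Pi: (P i); last by apply: polynomial_ext IH => t; rewrite big_cons Pi.
apply: polynomial_ext (polynomial_add (pF i) IH) => t.
by rewrite big_cons Pi.
Qed.

Lemma polynomial_prod (I : Type) (s : seq I) (F : I -> T -> k) :
  (forall i, polynomial e (F i)) ->
  polynomial e (fun t => \prod_(i <- s) F i t).
Proof.
move=> pF; elim: s => [|i s IH].
  by apply: polynomial_ext (polynomial_const 1) => t; rewrite big_nil.
by apply: polynomial_ext (polynomial_mul (pF i) IH) => t; rewrite big_cons.
Qed.

Lemma polynomial_meval l (F : 'I_l -> T -> k) (p : {mpoly k[l]}) :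
  (forall i, polynomial e (F i)) -> polynomial e (fun t => p.@[fun i => F i t]).
Proof.
move=> pF; elim/mpoly_ring_ind: p => [c|i|p q|p q].
- by apply: polynomial_ext (polynomial_const c) => t; rewrite mevalC.
- by apply: polynomial_ext (pF i) => t; rewrite mevalXU.
- by move=> pp pq; apply: polynomial_ext (polynomial_add pp pq) => t; rewrite mevalD.
- by move=> pp pq; apply: polynomial_ext (polynomial_mul pp pq) => t; rewrite mevalM.
Qed.

Lemma polynomial_choice l (f : T -> 'rV[k]_l) :
  (forall i, polynomial e (fun t => f t 0 i)) ->
  exists P : 'I_l -> {mpoly k[m]}, forall t, f t = poly_map P (e t).
Proof.
move=> /choice[P fP]; exists P => t; apply/rowP => i; by rewrite mxE fP.
Qed.

End Polynomial.

Lemma polynomial_comp T S m l (e : T -> 'rV[k]_m) (e' : S -> 'rV[k]_l)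
    (g : S -> T) (F : T -> k) :
  polynomial e F -> (forall i, polynomial e' (fun s => e (g s) 0 i)) ->
  polynomial e' (fun s => F (g s)).
Proof.
move=> [p Fp] eg; apply: polynomial_ext (polynomial_meval p eg) => s /=.
by rewrite Fp.
Qed.

Lemma zclosed_eq m (F G : 'rV[k]_m -> k) :
  polynomial id F -> polynomial id G -> zclosed [set c | F c = G c]%classic.
Proof.
move=> pF pG; have [p FGp] := polynomial_sub pF pG.
exists [set p]%classic; apply/seteqP; split=> c /= FG.
  by move=> _ ->; rewrite -FGp FG subrr.
by apply/eqP; rewrite -subr_eq0 FGp FG.
Qed.

Lemma zclosed_forall m (I : Type) (A : I -> 'rV[k]_m -> Prop) :
  (forall i, zclosed [set c | A i c]%classic) ->
  zclosed [set c | forall i, A i c]%classic.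
Proof.
move=> /choice[S AS]; exists [set p | exists i, S i p]%classic.
apply/seteqP; split=> c /= Ac.
  by move=> p [i Sip]; have := Ac i; rewrite -/([set c | A i c]%classic c) AS; apply.
by move=> i; rewrite -/([set c | A i c]%classic c) AS => p Sip; apply: Ac; exists i.
Qed.

Lemma zclosed_and m (A A' : 'rV[k]_m -> Prop) :
  zclosed [set c | A c]%classic -> zclosed [set c | A' c]%classic ->
  zclosed [set c | A c /\ A' c]%classic.
Proof.
move=> cA cA'; have := @zclosed_forall m bool (fun b => if b then A else A').
move=> /(_ (fun b => if b return zclosed [set c | (if b then A else A') c]%classic
  then cA else cA')); congr zclosed; apply/seteqP; split=> c /=.
  by move=> AA; split; [apply: (AA true) | apply: (AA false)].
by move=> [Ac A'c] [].
Qed.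

Lemma zclosed_eq_row m l (v w : 'rV[k]_m -> 'rV[k]_l) :
  (forall i, polynomial id (fun c => v c 0 i)) ->
  (forall i, polynomial id (fun c => w c 0 i)) ->
  zclosed [set c | v c = w c]%classic.
Proof.
move=> pv pw; have -> : [set c | v c = w c]%classic =
    [set c | forall i, v c 0 i = w c 0 i]%classic.
  apply/seteqP; split=> c /=; first by move=> ->.
  by move=> vw; apply/rowP.
by apply: zclosed_forall => i; apply: zclosed_eq.
Qed.

Lemma zclosed_preim m l (Z : set 'rV[k]_m) (F : 'rV[k]_l -> 'rV[k]_m) :
  zclosed Z -> (forall i, polynomial id (fun c => F c 0 i)) ->
  zclosed [set c | Z (F c)]%classic.
Proof.
move=> [S ->] pF.
have := @zclosed_forall l {p | S p} (fun p c => (sval p).@[(F c) 0] = 0).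
case=> [[p Sp]|Q e].
  apply: zclosed_eq; last exact: polynomial_const.
  by apply: (polynomial_comp (e := id) (F := fun x => p.@[x 0])) => //; exists p.
exists Q; rewrite -e; apply/seteqP; split=> c /= cS; last first.
  by move=> p Sp; apply: (cS (exist _ p Sp)).
by move=> [p Sp]; apply: cS.
Qed.

End PolynomialFunctions.

(** * The coordinate ring of an affine variety *)

Section CoordinateRing.
Context {k : closedFieldType} {n : nat} {X : set 'rV[k]_n}.

Definition pt (x : X) : 'rV[k]_n := val x.

Lemma pt_inj x y : (forall i, pt x 0 i = pt y 0 i) -> x = y.
Proof. by move=> xy; apply/val_inj/rowP. Qed.

(** The representing polynomial is only required to exist. The vanishing ideal is thereby divided
    out, and equality in [k[X]] is pointwise. *)
Record polyfun := PolyFun {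
  pf_fun :> X -> k;
  pf_polynomial : polynomial pt pf_fun }.

Lemma polyfunP (a b : polyfun) : (forall x, a x = b x) -> a = b.
Proof.
case: a b => [a pa] [b pb] /= ab; have {}ab : a = b by apply/funext.
by subst b; rewrite (Prop_irrelevance pa pb).
Qed.

HB.instance Definition _ := gen_eqMixin polyfun.
HB.instance Definition _ := gen_choiceMixin polyfun.

Definition cst c := PolyFun (polynomial_const pt c).
Definition coord i := PolyFun (polynomial_coord pt i).
Definition pf_add (a b : polyfun) :=
  PolyFun (polynomial_add (pf_polynomial a) (pf_polynomial b)).
Definition pf_opp (a : polyfun) := PolyFun (polynomial_opp (pf_polynomial a)).
Definition pf_mul (a b : polyfun) :=
  PolyFun (polynomial_mul (pf_polynomial a) (pf_polynomial b)).

Lemma pf_addA : associative pf_add.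
Proof. by move=> a b c; apply: polyfunP => x /=; rewrite addrA. Qed.
Lemma pf_addC : commutative pf_add.
Proof. by move=> a b; apply: polyfunP => x /=; rewrite addrC. Qed.
Lemma pf_add0 : left_id (cst 0) pf_add.
Proof. by move=> a; apply: polyfunP => x /=; rewrite add0r. Qed.
Lemma pf_addN : left_inverse (cst 0) pf_opp pf_add.
Proof. by move=> a; apply: polyfunP => x /=; rewrite addNr. Qed.

HB.instance Definition _ :=
  GRing.isZmodule.Build polyfun pf_addA pf_addC pf_add0 pf_addN.

Lemma pf_mulA : associative pf_mul.
Proof. by move=> a b c; apply: polyfunP => x /=; rewrite mulrA. Qed.
Lemma pf_mulC : commutative pf_mul.
Proof. by move=> a b; apply: polyfunP => x /=; rewrite mulrC. Qed.
Lemma pf_mul1 : left_id (cst 1) pf_mul.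
Proof. by move=> a; apply: polyfunP => x /=; rewrite mul1r. Qed.
Lemma pf_mulDl : left_distributive pf_mul pf_add.
Proof. by move=> a b c; apply: polyfunP => x /=; rewrite mulrDl. Qed.

HB.instance Definition _ := GRing.Zmodule_isComPzRing.Build polyfun
  pf_mulA pf_mulC pf_mul1 pf_mulDl.

Lemma pf0E x : (0 : polyfun) x = 0. Proof. by []. Qed.
Lemma pf1E x : (1 : polyfun) x = 1. Proof. by []. Qed.
Lemma pfDE (a b : polyfun) x : (a + b) x = a x + b x. Proof. by []. Qed.
Lemma pfNE (a : polyfun) x : (- a) x = - a x. Proof. by []. Qed.
Lemma pfME (a b : polyfun) x : (a * b) x = a x * b x. Proof. by []. Qed.
Lemma cstE c x : cst c x = c. Proof. by []. Qed.
Lemma coordE i x : coord i x = pt x 0 i. Proof. by []. Qed.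

Lemma pf_sumE (I : Type) (s : seq I) (P : pred I) (F : I -> polyfun) x :
  (\sum_(i <- s | P i) F i) x = \sum_(i <- s | P i) F i x.
Proof. by rewrite (big_morph (fun a : polyfun => a x) (id1 := 0) (op1 := +%R)). Qed.

Lemma pfMnE (a : polyfun) j x : (a *+ j) x = a x *+ j.
Proof. by elim: j => [|j IH]; rewrite ?mulr0n // !mulrS pfDE IH. Qed.

Lemma pfXE (a : polyfun) j x : (a ^+ j) x = a x ^+ j.
Proof. by elim: j => [|j IH]; rewrite ?expr0 // !exprS pfME IH. Qed.

Definition pfE :=
  (pf0E, pf1E, pfDE, pfNE, pfME, cstE, coordE, pf_sumE, pfMnE, pfXE).

(* Outside the polynomial functions [to_pf] has the junk value 0. *)
Definition to_pf (f : X -> k) : polyfun :=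
  if pselect (polynomial pt f) is left pf then PolyFun pf else 0.

Lemma to_pfE f x : polynomial pt f -> to_pf f x = f x.
Proof. by rewrite /to_pf; case: pselect. Qed.

Lemma polyfun_neq0 (a : polyfun) : a != 0 -> exists x, a x != 0.
Proof.
move=> a0; apply: contrapT => na; case/eqP: a0; apply: polyfunP => x.
by apply/eqP/negPn/negP => ax; apply: na; exists x.
Qed.

Lemma morphismP (f : X -> X) :
  morphism f <-> forall i, polynomial pt (fun x => pt (f x) 0 i).
Proof.
split=> [[P fP] i|/polynomial_choice[P fP]]; last by exists P.
by exists (P i) => x; rewrite /pt fP mxE.
Qed.

Lemma morphism_comp_polynomial (f : X -> X) (a : X -> k) :
  morphism f -> polynomial pt a -> polynomial pt (fun x => a (f x)).
Proof. by move=> /morphismP mf pa; apply: polynomial_comp pa mf. Qed.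

Lemma morphism_comp (f g : X -> X) : morphism f -> morphism g -> morphism (f \o g).
Proof.
move=> /morphismP mf mg; apply/morphismP => i.
exact: (morphism_comp_polynomial mg (mf i)).
Qed.

Lemma morphism_id : morphism (id : X -> X).
Proof. by apply/morphismP => i; apply: polynomial_coord. Qed.

(** The comorphism of [f]; it is meaningful when [f] is a morphism, as otherwise [to_pf] may return
    its junk value. *)
Definition pull (f : X -> X) (a : polyfun) : polyfun := to_pf (fun x => a (f x)).

Lemma pullE f a x : morphism f -> pull f a x = a (f x).
Proof.
move=> mf; rewrite to_pfE //; apply: morphism_comp_polynomial mf _.
exact: pf_polynomial.
Qed.

Section Irreducible.
Hypothesis X_irr : irreducible X.

Lemma zclosed_vanishing (a : polyfun) : exists2 Z : set 'rV[k]_n,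
  zclosed Z & forall x : X, Z (val x) <-> a x = 0.
Proof.
have [p ap] := pf_polynomial a; exists (zeros [set p]%classic).
  by exists [set p]%classic.
by move=> x; rewrite ap; split=> [|px _ ->] //; apply.
Qed.

(** The zero loci of [a] and [b] cover [X], so by irreducibility one of them contains [X]. *)
Lemma polyfun_integral (a b : polyfun) : a * b = 0 -> a = 0 \/ b = 0.
Proof.
move=> ab0; have [Z cZ Za] := zclosed_vanishing a.
have [W cW Wb] := zclosed_vanishing b.
have [] := X_irr.2 _ _ cZ cW.
- move=> x xX; have : (a * b) (SigSub (mem_set xX)) = 0 by rewrite ab0.
  move=> /eqP; rewrite pfE mulf_eq0 => /orP[] /eqP.
    by move=> /Za; left.
  by move=> /Wb; right.
- by move=> XZ; left; apply: polyfunP => x; apply/Za/XZ/set_mem/valP.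
- by move=> XW; right; apply: polyfunP => x; apply/Wb/XW/set_mem/valP.
Qed.

Lemma polyfun_nontrivial : 1 != 0 :> polyfun.
Proof.
have [x xX] := X_irr.1; apply/eqP => e.
have : (1 : polyfun) (SigSub (mem_set xX)) = 0 by rewrite e.
by rewrite pfE => /eqP; rewrite oner_eq0.
Qed.

Lemma polyfun_mul_neq0 (a b : polyfun) : a != 0 -> b != 0 -> a * b != 0.
Proof.
by move=> /eqP a0 /eqP b0; apply/eqP => /polyfun_integral[].
Qed.

Lemma polyfun_torsion_free (k_char0 : [pchar k] =i pred0) (a : polyfun) d :
  a *+ d.+1 = 0 -> a = 0.
Proof.
move=> ad; apply: polyfunP => x; apply/eqP.
have : (a *+ d.+1) x = 0 by rewrite ad.
rewrite pfE -mulr_natr => /eqP; rewrite mulf_eq0 (proj1 (pcharf0P k) k_char0).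
by rewrite orbF.
Qed.

End Irreducible.
End CoordinateRing.
Arguments polyfun {k n} X.

(** * Additive group actions and their generators *)

Section CharacteristicZero.
Context {k : closedFieldType} (k_char0 : [pchar k] =i pred0).

Lemma natr_neq0 j : (j.+1%:R : k) != 0.
Proof. by rewrite (proj1 (pcharf0P k) k_char0). Qed.

Lemma natr_inj : injective (fun j : nat => j%:R : k).
Proof.
move=> i j; wlog ij : i j / (i <= j)%N.
  by move=> W; case: (leqP i j) => [|/ltnW] ij e; [exact: W | apply/esym/W].
move=> /esym/eqP; rewrite -subr_eq0 -natrB //= (proj1 (pcharf0P k) k_char0).
by rewrite subn_eq0 => ji; apply/eqP; rewrite eqn_leq ij.
Qed.

(** In characteristic zero the natural numbers are infinitely many points of [k]. Identities in a
    time parameter can therefore be checked on iterates alone. *)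
Lemma poly_eq_nat (p q : {poly k}) :
  (forall j : nat, p.[j%:R] = q.[j%:R]) -> p = q.
Proof.
move=> pq; apply/eqP; rewrite -subr_eq0; apply/negPn/negP => d0.
have := max_poly_roots (rs := [seq j%:R | j <- iota 0 (size (p - q))]) d0.
rewrite size_map size_iota ltnn => H; suff : false by [].
apply: H; last by rewrite map_inj_uniq ?iota_uniq //; apply: natr_inj.
by apply/allP => _ /mapP[j _ ->]; rewrite rootE !hornerE pq subrr.
Qed.

Lemma poly_eq_fun (p q : {poly k}) : (forall s, p.[s] = q.[s]) -> p = q.
Proof. by move=> pq; apply: poly_eq_nat => j. Qed.

Lemma mulrn_eq0_char0 (c : k) j : (0 < j)%N -> c *+ j = 0 -> c = 0.
Proof.
case: j => // j _ /eqP; rewrite -mulr_natr mulf_eq0 (negPf (natr_neq0 j)) orbF.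
by move=> /eqP.
Qed.

Lemma coef1_deriv (p : {poly k}) : p`_1 = p^`().[0].
Proof. by rewrite horner_coef0 coef_deriv mulr1n. Qed.

Section GaActions.
Context {n : nat} {X : set 'rV[k]_n}.

(** An element of [k[X][s]] seen as a family of univariate polynomials; the uniform bound on the
    size makes it polynomial on [k * X]. *)
Definition poly_family (q : X -> {poly k}) : Prop :=
  (exists N, forall x, (size (q x) <= N)%N) /\
  forall j, polynomial pt (fun x => (q x)`_j).

Lemma poly_family_ext q q' : q =1 q' -> poly_family q -> poly_family q'.
Proof.
move=> qq' [[N qN] pq]; split; first by exists N => x; rewrite -qq'.
by move=> j; apply: polynomial_ext (pq j) => x; rewrite qq'.
Qed.

Lemma poly_family_const p : poly_family (fun=> p).
Proof.
by split; [exists (size p) | move=> j; apply: polynomial_const].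
Qed.

Lemma poly_family_polyC a : polynomial pt a -> poly_family (fun x => (a x)%:P).
Proof.
move=> pa; split; first by exists 1%N => x; apply: size_polyC_leq1.
case=> [|j]; first by apply: polynomial_ext pa => x; rewrite coefC.
by apply: polynomial_ext (polynomial_const pt 0) => x; rewrite coefC.
Qed.

Lemma poly_family_add q q' :
  poly_family q -> poly_family q' -> poly_family (fun x => q x + q' x).
Proof.
move=> [[N qN] pq] [[N' qN'] pq']; split.
  exists (maxn N N') => x; rewrite (leq_trans (size_polyD _ _)) //.
  by rewrite geq_max !leq_max qN qN' orbT.
move=> j; apply: polynomial_ext (polynomial_add (pq j) (pq' j)) => x.
by rewrite coefD.
Qed.

Lemma poly_family_mul q q' :
  poly_family q -> poly_family q' -> poly_family (fun x => q x * q' x).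
Proof.
move=> [[N qN] pq] [[N' qN'] pq']; split.
  exists (N + N')%N => x; rewrite (leq_trans (size_polyMleq _ _)) //.
  by rewrite (leq_trans (leq_pred _)) // leq_add.
move=> j; apply: (polynomial_ext (F := fun x =>
  \sum_(i < j.+1) (q x)`_i * (q' x)`_(j - i))) => [x|]; first by rewrite coefM.
by apply: polynomial_sum => i; apply: polynomial_mul.
Qed.

Lemma poly_family_sum (I : Type) (s : seq I) (q : I -> X -> {poly k}) :
  (forall i, poly_family (q i)) -> poly_family (fun x => \sum_(i <- s) q i x).
Proof.
move=> qf; elim: s => [|i s IH].
  by apply: poly_family_ext (poly_family_const 0) => x; rewrite big_nil.
by apply: poly_family_ext (poly_family_add (qf i) IH) => x; rewrite big_cons.
Qed.

Definition act_pt (sx : k * X) : 'rV[k]_(1 + n) := row_mx sx.1%:M (pt sx.2).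

Lemma act_pt_l (sx : k * X) (j : 'I_1) : act_pt sx 0 (lshift n j) = sx.1.
Proof. by rewrite row_mxEl [j]ord1 mxE mulr1n. Qed.

Lemma act_pt_r (sx : k * X) j : act_pt sx 0 (rshift 1 j) = pt sx.2 0 j.
Proof. by rewrite row_mxEr. Qed.

Lemma poly_family_of_polynomial F : polynomial act_pt F ->
  exists q, poly_family q /\ forall s x, F (s, x) = (q x).[s].
Proof.
move=> [p Fp].
suff [q [qf pq]] : exists q, poly_family q /\
    forall s x, p.@[act_pt (s, x) 0] = (q x).[s].
  by exists q; split=> // s x; rewrite Fp pq.
move: p {Fp}; apply: mpoly_ring_ind => [c|i|p p'|p p'].
- exists (fun=> c%:P); split; first exact: poly_family_const.
  by move=> s x; rewrite mevalC hornerE.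
- rewrite -(splitK i); case: (split i) => j /=.
    exists (fun=> 'X); split; first exact: poly_family_const.
    by move=> s x; rewrite mevalXU act_pt_l hornerX.
  exists (fun x => (pt x 0 j)%:P); split.
    exact/poly_family_polyC/polynomial_coord.
  by move=> s x; rewrite mevalXU act_pt_r hornerC.
- move=> [q [qf pq]] [q' [qf' pq']]; exists (fun x => q x + q' x); split.
    exact: poly_family_add.
  by move=> s x; rewrite mevalD pq pq' hornerE.
- move=> [q [qf pq]] [q' [qf' pq']]; exists (fun x => q x * q' x); split.
    exact: poly_family_mul.
  by move=> s x; rewrite mevalM pq pq' hornerE.
Qed.

Lemma polynomial_of_poly_family q : poly_family q ->
  polynomial act_pt (fun sx => (q sx.2).[sx.1]).
Proof.
move=> [[N qN] pq].
apply: (polynomial_ext (F := fun sx => \sum_(j < N) (q sx.2)`_j * sx.1 ^+ j)).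
  by move=> sx; rewrite (horner_coef_wide _ (qN _)).
apply: polynomial_sum => j; apply: polynomial_mul.
  apply: polynomial_comp (pq j) _ => i.
  apply: polynomial_ext (polynomial_coord act_pt (rshift 1 i)) => sx.
  by rewrite act_pt_r.
apply: polynomial_exp.
apply: polynomial_ext (polynomial_coord act_pt (lshift n 0)) => sx.
by rewrite act_pt_l.
Qed.

Lemma polynomial_scalar : polynomial act_pt (fun sx => sx.1).
Proof.
apply: polynomial_ext (polynomial_of_poly_family (poly_family_const 'X)) => sx.
by rewrite hornerE.
Qed.

Lemma polynomial_snd a : polynomial pt a -> polynomial act_pt (fun sx => a sx.2).
Proof.
move=> /poly_family_polyC/polynomial_of_poly_family; apply: polynomial_ext => sx.
by rewrite hornerE.
Qed.

Lemma Ga_actionP (rho : k -> X -> X) : Ga_action rho <->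
  [/\ forall i, polynomial act_pt (fun sx => pt (rho sx.1 sx.2) 0 i),
    rho 0 = id & forall s t, rho (s + t) = rho s \o rho t].
Proof.
split=> [[[P rP] r0 rD]|[pr r0 rD]]; split=> //.
  by move=> i; exists (P i) => -[s x]; rewrite /pt rP mxE.
have [P rP] := polynomial_choice pr; exists P => s x.
exact: (rP (s, x)).
Qed.

Record gact := Gact { ga_fun :> k -> X -> X; ga_action : Ga_action ga_fun }.

Implicit Types (rho sigma : gact) (a b : polyfun X).

Lemma gact0 rho x : rho 0 x = x.
Proof. by have [_ ->] := ga_action rho. Qed.

Lemma gactD rho s t x : rho (s + t) x = rho s (rho t x).
Proof. by have [_ _ ->] := ga_action rho. Qed.

Lemma gactNK rho s x : rho (- s) (rho s x) = x.
Proof. by rewrite -gactD addNr gact0. Qed.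

Lemma gactK rho s x : rho s (rho (- s) x) = x.
Proof. by rewrite -gactD subrr gact0. Qed.

Lemma gact_polynomial rho i :
  polynomial act_pt (fun sx => pt (rho sx.1 sx.2) 0 i).
Proof. by have /Ga_actionP[] := ga_action rho. Qed.

Lemma gact_morphism rho s : morphism (rho s).
Proof.
apply/morphismP => i.
apply: (polynomial_comp (g := fun x => (s, x)) (gact_polynomial rho i)) => j.
rewrite -(splitK j); case: (split j) => l /=.
  apply: polynomial_ext (polynomial_const pt s) => x.
  by rewrite act_pt_l.
by apply: polynomial_ext (polynomial_coord pt l) => x; rewrite act_pt_r.
Qed.

Lemma gact_Aut rho s : Aut (rho s).
Proof.
split; first exact: gact_morphism.
exists (rho (- s)); split; first exact: gact_morphism.
  by move=> x; rewrite gactNK.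
by move=> x; rewrite gactK.
Qed.

Lemma orbit_exists rho b : exists q, poly_family q /\
  forall s x, b (rho s x) = (q x).[s].
Proof.
have := poly_family_of_polynomial (polynomial_comp (pf_polynomial b)
  (fun i => gact_polynomial rho i)).
by [].
Qed.

(** The choice is harmless: by [orb_eq] the polynomial is determined by its values. *)
Definition orb rho b : X -> {poly k} := sval (cid (orbit_exists rho b)).

Lemma orb_family rho b : poly_family (orb rho b).
Proof. by rewrite /orb; case: cid => q []. Qed.

Lemma orbE rho b s x : b (rho s x) = (orb rho b x).[s].
Proof. by rewrite /orb; case: cid => q []. Qed.

Lemma orb_eq rho b x p : (forall s, b (rho s x) = p.[s]) -> orb rho b x = p.
Proof. by move=> bp; apply: poly_eq_fun => s; rewrite -orbE. Qed.

Definition orb_coef rho b j : polyfun X := PolyFun ((orb_family rho b).2 j).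

Definition gen rho b : polyfun X := orb_coef rho b 1.

Lemma genE rho b x : gen rho b x = (orb rho b x)`_1. Proof. by []. Qed.

Lemma gen_derivation rho : derivation (gen rho).
Proof.
split=> a b; apply: polyfunP => x; rewrite genE.
  rewrite (@orb_eq _ _ _ (orb rho a x + orb rho b x)) => [|s].
    by rewrite coefD pfE.
  by rewrite hornerE -!orbE.
rewrite (@orb_eq _ _ _ (orb rho a x * orb rho b x)) => [|s].
  rewrite coefM big_ord_recl big_ord1 !pfE /= subn0 addrC -!horner_coef0 -!orbE.
  by rewrite gact0.
by rewrite hornerE -!orbE.
Qed.

(** The flow law: seen from [rho s x], the orbit polynomial is translated by [s], and the linear
    coefficient of the translate is the derivative at [s]. *)
Lemma orb_gen rho b x : orb rho (gen rho b) x = (orb rho b x)^`().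
Proof.
apply: orb_eq => s; rewrite genE.
rewrite (@orb_eq _ _ _ (orb rho b x \Po ('X + s%:P))) => [|t].
  rewrite coef1_deriv deriv_comp !derivE addr0 mulr1 horner_comp.
  by rewrite !hornerE.
by rewrite horner_comp !hornerE -orbE gactD.
Qed.

Lemma orb_iter_gen rho j b x :
  orb rho (iter j (gen rho) b) x = (orb rho b x)^`(j).
Proof. by elim: j => [|j IH]; rewrite // iterS orb_gen IH -derivnS. Qed.

Lemma orb_0 rho b x : (orb rho b x)`_0 = b x.
Proof. by rewrite -horner_coef0 -orbE gact0. Qed.

(** Taylor's formula along an orbit. Since orbit polynomials have bounded degree it yields local
    nilpotency, and in characteristic zero it shows that the generator determines the action. *)
Lemma iter_genE rho j b x :
  iter j (gen rho) b x = (orb rho b x)`_j *+ j`!.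
Proof. by rewrite -(orb_0 rho (iter j _ b)) orb_iter_gen coef_derivn addn0 ffactnn. Qed.

Lemma gen_nilpotent rho b : exists m, iter m (gen rho) b = 0.
Proof.
have [[N bN] _] := orb_family rho b; exists N; apply: polyfunP => x.
by rewrite iter_genE nth_default // mul0rn.
Qed.

Lemma orb_eq_iter rho sigma a b x y :
  (forall j, iter j (gen rho) a x = iter j (gen sigma) b y) ->
  orb rho a x = orb sigma b y.
Proof.
move=> e; apply/polyP => j; apply/eqP; rewrite -subr_eq0; apply/eqP.
apply: (@mulrn_eq0_char0 _ j`!); first exact: fact_gt0.
by rewrite mulrnBl -!iter_genE e subrr.
Qed.

Lemma gen_eq0 rho b : gen rho b = 0 <-> forall s x, b (rho s x) = b x.
Proof.
split=> [b0 s x|inv].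
  rewrite orbE; suff -> : orb rho b x = (b x)%:P by rewrite hornerE.
  apply/polyP => -[|j]; rewrite coefC; first exact: orb_0.
  apply: (@mulrn_eq0_char0 _ j.+1`!); first exact: fact_gt0.
  rewrite -iter_genE iterSr b0; suff -> : iter j (gen rho) 0 = 0 by [].
  by elim: j => //= j ->; apply/der0/gen_derivation.
apply: polyfunP => x; rewrite genE (@orb_eq _ _ _ (b x)%:P) ?coefC // => s.
by rewrite hornerE.
Qed.

Lemma gen_cst rho c : gen rho (cst c) = 0.
Proof. by apply/gen_eq0. Qed.

Lemma gen_cstM rho c a : gen rho (cst c * a) = cst c * gen rho a.
Proof. exact/(derMc (gen_derivation rho))/gen_cst. Qed.

Lemma gen_pull rho f b : morphism f -> (forall s x, rho s (f x) = f (rho s x)) ->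
  gen rho (pull f b) = pull f (gen rho b).
Proof.
move=> mf cf; apply: polyfunP => x; rewrite pullE // !genE.
rewrite (@orb_eq _ _ x (orb rho b (f x))) // => s.
by rewrite pullE // -cf orbE.
Qed.

Definition commuting rho sigma :=
  forall s t x, rho s (sigma t x) = sigma t (rho s x).

Lemma orb_coefE rho b j x : orb_coef rho b j x = (orb rho b x)`_j.
Proof. by []. Qed.

(** The number of terms may be any large [m], so that later proofs can make sure that the terms of
    degree 0 and 1 occur. *)
Lemma pull_gact rho b : exists N, forall m s, (N <= m)%N ->
  pull (rho s) b = \sum_(j < m) cst (s ^+ j) * orb_coef rho b j.
Proof.
have [[N bN] _] := orb_family rho b; exists N => m s Nm; apply: polyfunP => x.
rewrite pullE; last exact: gact_morphism.
rewrite orbE (horner_coef_wide _ (leq_trans (bN x) Nm)) pfE.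
by apply: eq_bigr => j _; rewrite pfE cstE mulrC.
Qed.

(** The operator [gen rho] is [k]-linear and commutes with [pull (sigma t)], whose expansion in [t]
    has linear coefficient [gen sigma]. *)
Lemma gen_commute rho sigma b : commuting rho sigma ->
  gen rho (gen sigma b) = gen sigma (gen rho b).
Proof.
move=> c; apply: polyfunP => x; rewrite [RHS]genE.
have [N bN] := pull_gact sigma b.
rewrite (@orb_eq _ _ _ (\poly_(j < N.+2) gen rho (orb_coef sigma b j) x)).
  by rewrite coef_poly.
move=> t; rewrite -(pullE _ _ (gact_morphism sigma t)).
rewrite -(gen_pull _ (gact_morphism sigma t)); last by move=> s y; apply: c.
rewrite (bN N.+2) ?(der_sum (gen_derivation rho)); last by rewrite ltnW.
rewrite horner_poly pfE; apply: eq_bigr => j _.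
by rewrite gen_cstM pfE cstE mulrC.
Qed.

Lemma gact_comp_subproof rho sigma : commuting rho sigma ->
  Ga_action (fun s => rho s \o sigma s).
Proof.
move=> c; apply/Ga_actionP; split.
- move=> i; apply: (polynomial_comp (g := fun sx : k * X => (sx.1, sigma sx.1 sx.2))
    (gact_polynomial rho i)) => j.
  rewrite -(splitK j); case: (split j) => l /=.
    apply: polynomial_ext polynomial_scalar => x.
    by rewrite act_pt_l.
  apply: polynomial_ext (gact_polynomial sigma l) => x.
  by rewrite act_pt_r.
- by apply/funext => x /=; rewrite !gact0.
- by move=> s t; apply/funext => x /=; rewrite !gactD -c.
Qed.

Definition gact_comp rho sigma (c : commuting rho sigma) :=
  Gact (gact_comp_subproof c).

Lemma gen_comp rho sigma (c : commuting rho sigma) b :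
  gen (gact_comp c) b = gen rho b + gen sigma b.
Proof.
apply: polyfunP => x; rewrite genE.
have [N bN] := pull_gact rho b.
(* Two terms contribute to the linear coefficient: [j = 0] gives [gen sigma b] and [j = 1] gives
   [gen rho b]. *)
rewrite (@orb_eq _ _ _
  (\sum_(j < N.+2) 'X^j * orb sigma (orb_coef rho b j) x)) => [|s].
  rewrite 2!big_ord_recl /= !coefD expr0 mul1r -genE expr1 coefXM /= orb_0.
  rewrite coef_sum big1 => [|j _]; last by rewrite coefXnM.
  rewrite addr0 addrC; suff -> : orb_coef rho b 0 = b by [].
  by apply: polyfunP => y; rewrite orb_coefE orb_0.
rewrite /= -(pullE _ _ (gact_morphism rho s)) (bN N.+2); last by rewrite ltnW.
rewrite horner_sum pfE; apply: eq_bigr => j _.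
by rewrite pfE cstE hornerM hornerXn orbE.
Qed.

Lemma gact_scale_subproof c rho : Ga_action (fun s => rho (c * s)).
Proof.
apply/Ga_actionP; split.
- move=> i; apply: (polynomial_comp (g := fun sx : k * X => (c * sx.1, sx.2))
    (gact_polynomial rho i)) => j.
  rewrite -(splitK j); case: (split j) => l /=.
    apply: polynomial_ext (polynomial_mul (polynomial_const _ c) polynomial_scalar).
    by move=> x; rewrite act_pt_l.
  apply: polynomial_ext (polynomial_snd (polynomial_coord pt l)) => x.
  by rewrite act_pt_r.
- by rewrite mulr0; apply/funext => x; rewrite gact0.
- by move=> s t; apply/funext => x /=; rewrite mulrDr gactD.
Qed.

Definition gact_scale c rho := Gact (gact_scale_subproof c rho).

Lemma gen_scale c rho b : gen (gact_scale c rho) b = cst c * gen rho b.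
Proof.
apply: polyfunP => x; rewrite genE.
rewrite (@orb_eq _ _ _ (orb rho b x \Po (c *: 'X))) => [|s].
  rewrite coef1_deriv deriv_comp derivZ derivX hornerM horner_comp.
  rewrite !hornerZ hornerX -[1]/(1%:P) hornerC mulr0 mulr1.
  by rewrite -coef1_deriv -genE pfE mulrC.
by rewrite horner_comp !hornerE -orbE.
Qed.

Lemma gact_id_subproof : Ga_action (fun (s : k) (x : X) => x).
Proof.
apply/Ga_actionP; split=> // i.
exact: polynomial_snd (polynomial_coord pt i).
Qed.

Definition gact_id := Gact gact_id_subproof.

Lemma gen_id b : gen gact_id b = 0.
Proof. by apply/gen_eq0. Qed.

End GaActions.
End CharacteristicZero.
Arguments gact {k n} X.

(** * Automorphisms commuting with a commutative unipotent group *)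

Section Centralizers.
Context {k : closedFieldType} (k_char0 : [pchar k] =i pred0).
Context {n : nat} {X : set 'rV[k]_n} (X_closed : zclosed X).

Lemma meval_horner l (p : {mpoly k[l]}) (q : 'I_l -> {poly k}) :
  exists r : {poly k}, forall s, r.[s] = p.@[fun i => (q i).[s]].
Proof.
move: p; apply: mpoly_ring_ind => [c|i|p p' [r rp] [r' rp']|p p' [r rp] [r' rp']].
- by exists c%:P => s; rewrite hornerC mevalC.
- by exists (q i) => s; rewrite mevalXU.
- by exists (r + r') => s; rewrite hornerD mevalD rp rp'.
- by exists (r * r') => s; rewrite hornerM mevalM rp rp'.
Qed.

(** Along the curve each equation of [Z] becomes a univariate polynomial that vanishes at all
    natural numbers. *)
Lemma zclosed_curve l (Z : set 'rV[k]_l) (v : k -> 'rV[k]_l) :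
  zclosed Z -> (forall i, exists r : {poly k}, forall s, v s 0 i = r.[s]) ->
  (forall j : nat, Z (v j%:R)) -> forall s, Z (v s).
Proof.
move=> [S ->] /choice[q vq] Zv s p Sp.
have [r rp] := meval_horner p q.
have pr t : p.@[v t 0] = r.[t].
  by rewrite rp; apply: meval_eq => i; rewrite vq.
rewrite pr (_ : r = 0) ?horner0 //.
by apply: (poly_eq_nat k_char0) => j; rewrite horner0 -pr Zv.
Qed.

(** The polynomials [q i x] define a point of affine space for every time [s], and it stays in [X]
    because [X] is closed. The group law spreads from natural times to all times, one variable after
    the other. *)
Lemma interpolation (h : X -> X) (q : 'I_n -> X -> {poly k}) :
  (forall i, poly_family (q i)) ->
  (forall m x i, pt (iter m h x) 0 i = (q i x).[m%:R]) ->
  exists rho : gact X, forall m x, rho m%:R x = iter m h x.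
Proof.
move=> qf hq; pose v s x := \row_i (q i x).[s].
have vh m x : v m%:R x = pt (iter m h x).
  by apply/rowP => i; rewrite mxE hq.
have vX s x : X (v s x).
  apply: (zclosed_curve (v := fun s => v s x)) => // [i|j].
    by exists (q i x) => t; rewrite mxE.
  by rewrite vh; apply/set_mem/valP.
pose rho s x : X := SigSub (mem_set (vX s x)).
have rhoE s x : pt (rho s x) = v s x by [].
have rhon m x : rho m%:R x = iter m h x by apply/val_inj/vh.
have pr i : polynomial act_pt (fun sx => pt (rho sx.1 sx.2) 0 i).
  apply: polynomial_ext (polynomial_of_poly_family (qf i)) => sx.
  by rewrite rhoE mxE.
(* For natural [m] both sides are polynomial in [s] and agree at natural [s], where the action
   iterates [h]. *)
have rhoDn s m x : rho (s + m%:R) x = rho s (rho m%:R x).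
  apply: pt_inj => i; rewrite !rhoE !mxE.
  have -> : (q i x).[s + m%:R] = (q i x \Po ('X + m%:R%:P)).[s].
    by rewrite horner_comp hornerD hornerX hornerC.
  congr (_.[s]); apply: (poly_eq_nat k_char0) => l.
  rewrite horner_comp hornerD hornerX hornerC -natrD -!hq rhon.
  by rewrite iterD.
have ga : Ga_action rho.
  apply/Ga_actionP; split=> //.
    by apply/funext => x; rewrite -[0]/(0%:R) rhon.
  move=> s t; apply/funext => x /=; apply: pt_inj => i.
  (* With [s] fixed, both sides are polynomial in [t], and [rhoDn] gives their agreement at natural
     [t]. *)
  have [p sp] : polynomial pt (fun y => pt (rho s y) 0 i).
    apply: (polynomial_comp (g := fun y => (s, y)) (pr i)) => j.
    rewrite -(splitK j); case: (split j) => l /=.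
      apply: polynomial_ext (polynomial_const pt s) => y.
      by rewrite act_pt_l.
    by apply: polynomial_ext (polynomial_coord pt l) => y; rewrite act_pt_r.
  rewrite sp; have [r rp] := meval_horner p (fun j => q j x).
  have -> : p.@[pt (rho t x) 0] = r.[t].
    by rewrite rp; apply: meval_eq => j; rewrite rhoE mxE.
  rewrite rhoE mxE.
  have -> : (q i x).[s + t] = (q i x \Po (s%:P + 'X)).[t].
    by rewrite horner_comp hornerD hornerX hornerC.
  congr (_.[t]); apply: (poly_eq_nat k_char0) => m.
  rewrite horner_comp hornerD hornerX hornerC rp.
  have := rhoDn s m x; move=> /(congr1 (fun y => pt y 0 i)).
  rewrite sp rhoE mxE => ->; apply: meval_eq => j.
  by rewrite rhoE mxE.
by exists (Gact ga).
Qed.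

(** Neither [N] nor the polynomials [r i j] depend on [s], so all [rho s] lie in a single
    [Aut(X)_d]. *)
Lemma gact_coefficients (rho : gact X) : exists N (r : 'I_n -> 'I_N -> {mpoly k[n]}),
  forall s x i, pt (rho s x) 0 i = \sum_(j < N) s ^+ j * (r i j).@[pt x 0].
Proof.
have /choice[N bN] : forall i, exists N, forall x,
    (size (orb rho (coord i) x) <= N)%N.
  by move=> i; have [[N]] := orb_family rho (coord i); exists N.
exists (\max_i N i).
have /choice[r rE] : forall ij : 'I_n * nat, exists p : {mpoly k[n]},
    forall x, (orb rho (coord ij.1) x)`_ij.2 = p.@[pt x 0].
  by move=> [i j]; have [_ /(_ j)] := orb_family rho (coord i).
exists (fun i j => r (i, val j)) => s x i.
rewrite -(coordE i) orbE (horner_coef_wide _ (leq_trans (bN i x) (leq_bigmax i))).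
by apply: eq_bigr => j _; rewrite mulrC (rE (i, val j)).
Qed.

(** * Closed subsets of the automorphism group *)

Definition coef_index d (e : 'I_(@coef_dim n d)) : 'I_n * 'X_{1..n < d.+1} :=
  enum_val e.

Definition coef_row d (P : 'I_n -> {mpoly k[n]}) : 'rV[k]_(coef_dim d) :=
  \row_e (P (coef_index e).1)@_(coef_index e).2.

Lemma poly_of_coef_row d (P : 'I_n -> {mpoly k[n]}) :
  (forall i, (msize (P i) <= d.+1)%N) -> poly_of_coef (coef_row d P) = P.
Proof.
move=> Pd; apply/funext => i; rewrite /poly_of_coef [RHS](mpolywE (Pd i)).
by apply: eq_bigr => m _; rewrite mxE /coef_index enum_rankK.
Qed.

(** The pairs [(rho t, rho (- t))] form a polynomial curve in the coefficient space of one degree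
    [d], to which [zclosed_curve] applies. *)
Lemma closed_contains_gact (S : set (X -> X)) (rho : gact X) :
  aut_closed S -> (forall j : nat, S (rho j%:R)) -> forall s, S (rho s).
Proof.
move=> S_closed Sn s.
have [N [r rE]] := gact_coefficients rho.
pose P s i := \sum_(j < N) s ^+ j *: r i j.
have PE t : represents (P t) (rho t).
  move=> x; apply/rowP => i; rewrite [LHS]rE mxE raddf_sum.
  by apply: eq_bigr => j _ /=; rewrite mevalZ.
pose d := \max_i \max_j msize (r i j).
have Pd t i : (msize (P t i) <= d.+1)%N.
  apply: leq_trans (msize_sum _ _ _) _.
  apply/bigmax_leqP_seq => j _ _; rewrite ltnW // ltnS.
  apply: leq_trans (msizeZ_le _ _) _.
  by apply: leq_trans (leq_bigmax i); apply: (leq_bigmax j).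
pose c t := coef_row d (P t).
have cE t : poly_of_coef (c t) = P t by apply/poly_of_coef_row/Pd.
have cpoly e : exists q : {poly k}, forall t, c t 0 e = q.[t].
  exists (\sum_(j < N) (r (coef_index e).1 j)@_(coef_index e).2 *: 'X^j) => t.
  rewrite mxE raddf_sum horner_sum; apply: eq_bigr => j _ /=.
  by rewrite mcoeffZ hornerZ hornerXn mulrC.
have [e|j|f [g [Sf _ _ fE _]]] := @zclosed_curve _ _
    (fun t => row_mx (c t) (c (- t))) (S_closed d) _ _ s.
- rewrite -(splitK e); case: (split e) => j /=.
    by have [q qE] := cpoly j; exists q => t; rewrite row_mxEl.
  have [q qE] := cpoly j; exists (q \Po (- 'X)) => t.
  by rewrite row_mxEr horner_comp hornerN hornerX qE.
- exists (rho j%:R), (rho (- j%:R)); rewrite row_mxKl row_mxKr !cE.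
  by split; [apply: Sn|exact: gactNK|exact: gactK|exact: PE|exact: PE].
suff <- : f = rho s by [].
by apply/funext => x; apply: val_inj; rewrite fE row_mxKl cE PE.
Qed.

Lemma polynomial_poly_of_coef T l (e : T -> 'rV[k]_l) d
    (C : T -> 'rV[k]_(@coef_dim n d)) (w : T -> 'rV[k]_n) i :
  (forall j, polynomial e (fun t => C t 0 j)) ->
  (forall j, polynomial e (fun t => w t 0 j)) ->
  polynomial e (fun t => poly_map (poly_of_coef (C t)) (w t) 0 i).
Proof.
move=> pC pw; apply: (polynomial_ext (F := fun t =>
  \sum_(m : 'X_{1..n < d.+1}) C t 0 (enum_rank (i, m)) *
    \prod_(j < n) w t 0 j ^+ (m : 'X_{1..n}) j)) => [t|].
  rewrite mxE raddf_sum; apply: eq_bigr => m _ /=.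
  by rewrite mevalZ mevalX.
apply: polynomial_sum => m; apply: polynomial_mul => //.
by apply: polynomial_prod => j; apply: polynomial_exp.
Qed.

(** That a pair of coefficient vectors defines mutually inverse maps of [X] is a closed condition,
    which leaves [Psi]. The argument of [Psi] takes values in affine space, because for arbitrary
    coefficients the map may leave [X]. *)
Lemma aut_closed_criterion (S : set (X -> X)) (Psi : (X -> 'rV[k]_n) -> Prop) :
  (forall f g : X -> X, morphism f -> morphism g -> cancel f g -> cancel g f ->
    (S f <-> Psi (fun x => pt (f x)))) ->
  (forall d l (C : 'rV[k]_l -> 'rV[k]_(@coef_dim n d)),
    (forall j, polynomial id (fun c => C c 0 j)) ->
    zclosed [set c | Psi (fun x => poly_map (poly_of_coef (C c)) (pt x))]%classic) ->
  aut_closed S.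
Proof.
move=> SPsi Psi_closed d; pose D := (@coef_dim n d + @coef_dim n d)%N.
pose Pl (c : 'rV[k]_D) :=
  poly_map (poly_of_coef (lsubmx c)) : 'rV[k]_n -> 'rV[k]_n.
pose Pr (c : 'rV[k]_D) :=
  poly_map (poly_of_coef (rsubmx c)) : 'rV[k]_n -> 'rV[k]_n.
have pl j : polynomial id (fun c : 'rV[k]_D => lsubmx c 0 j).
  by apply: polynomial_ext (polynomial_coord id (lshift _ j)) => c; rewrite mxE.
have pr j : polynomial id (fun c : 'rV[k]_D => rsubmx c 0 j).
  by apply: polynomial_ext (polynomial_coord id (rshift _ j)) => c; rewrite mxE.
have : zclosed [set c : 'rV[k]_D | (forall x : X, X (Pl c (pt x))) /\
  (forall x : X, X (Pr c (pt x))) /\ (forall x : X, Pr c (Pl c (pt x)) = pt x) /\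
  (forall x : X, Pl c (Pr c (pt x)) = pt x) /\ Psi (fun x => Pl c (pt x))]%classic.
  have H1 : zclosed [set c : 'rV[k]_D | forall x : X, X (Pl c (pt x))]%classic.
    apply: zclosed_forall => x; apply: zclosed_preim => // i.
    by apply: polynomial_poly_of_coef => // j; apply: polynomial_const.
  have H2 : zclosed [set c : 'rV[k]_D | forall x : X, X (Pr c (pt x))]%classic.
    apply: zclosed_forall => x; apply: zclosed_preim => // i.
    by apply: polynomial_poly_of_coef => // j; apply: polynomial_const.
  have H3 : zclosed [set c | forall x : X, Pr c (Pl c (pt x)) = pt x]%classic.
    apply: zclosed_forall => x; apply: zclosed_eq_row => i; last exact: polynomial_const.
    apply: polynomial_poly_of_coef => // j.
    by apply: polynomial_poly_of_coef => // j'; apply: polynomial_const.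
  have H4 : zclosed [set c | forall x : X, Pl c (Pr c (pt x)) = pt x]%classic.
    apply: zclosed_forall => x; apply: zclosed_eq_row => i; last exact: polynomial_const.
    apply: polynomial_poly_of_coef => // j.
    by apply: polynomial_poly_of_coef => // j'; apply: polynomial_const.
  have H5 := Psi_closed d D _ pl.
  exact: zclosed_and H1 (zclosed_and H2 (zclosed_and H3 (zclosed_and H4 H5))).
congr zclosed; apply/seteqP; split=> c /=; last first.
  move=> [f [g [Sf fg gf fE gE]]]; rewrite /Pl /Pr.
  split=> [x|]; first by rewrite -fE; apply/set_mem/valP.
  split=> [x|]; first by rewrite -gE; apply/set_mem/valP.
  split=> [x|]; first by rewrite -fE -gE fg.
  split=> [x|]; first by rewrite -gE -fE gf.
  have mf : morphism f by exists (poly_of_coef (lsubmx c)).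
  have mg : morphism g by exists (poly_of_coef (rsubmx c)).
  have := (SPsi f g mf mg fg gf).1 Sf; congr Psi; apply/funext => x; exact: fE.
move=> [lX [rX [rl [lr Psic]]]].
pose f x : X := SigSub (mem_set (lX x)); pose g x : X := SigSub (mem_set (rX x)).
have fE x : pt (f x) = Pl c (pt x) by [].
have gE x : pt (g x) = Pr c (pt x) by [].
have fg : cancel f g by move=> x; apply: val_inj; apply: rl.
have gf : cancel g f by move=> x; apply: val_inj; apply: lr.
have mf : morphism f by exists (poly_of_coef (lsubmx c)).
have mg : morphism g by exists (poly_of_coef (rsubmx c)).
exists f, g; split=> //.
by apply/(SPsi f g).
Qed.

(** * One-parameter subgroups and slices of a commutative unipotent group *)

Definition invariant (U : set (X -> X)) (a : polyfun X) : Prop :=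
  forall u, U u -> forall x, a (u x) = a x.

Definition one_param (U : set (X -> X)) (rho : gact X) : Prop :=
  forall s, U (rho s).

Lemma one_param_of_elt (U : set (X -> X)) (rho : gact X) :
  aut_subgroup U -> aut_closed U -> U (rho 1) -> one_param U rho.
Proof.
move=> [_ U1 UM _] U_closed U_rho; apply: closed_contains_gact => //.
elim=> [|j IH].
  suff -> : (rho 0%:R : X -> X) = id by [].
  by apply/funext => x; rewrite gact0.
suff -> : (rho j.+1%:R : X -> X) = rho j%:R \o rho 1 by apply: UM.
by apply/funext => x /=; rewrite -gactD natr1.
Qed.

Lemma one_param_exists (U : set (X -> X)) u : unipotent_subgroup U -> U u ->
  exists2 rho : gact X, (rho 1 : X -> X) = u & one_param U rho.
Proof.
move=> [U_group U_closed U_unip] Uu; have [rho [s [ga us]]] := U_unip _ Uu.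
(* The element [u] occurs at some time [s]; rescaling moves it to time 1. *)
exists (gact_scale s (Gact ga)); first by rewrite /= mulr1 us.
by apply: one_param_of_elt => //=; rewrite mulr1 -us.
Qed.

Lemma one_param_commuting (U : set (X -> X)) rho sigma : commutative_set U ->
  one_param U rho -> one_param U sigma -> commuting rho sigma.
Proof.
by move=> comU Ur Us s t x; have /(congr1 (@^~ x)) := comU _ _ (Ur s) (Us t).
Qed.

Lemma derivation_eq0 (E : polyfun X -> polyfun X) : derivation E ->
  (forall c, E (cst c) = 0) -> (forall i, E (coord i) = 0) -> forall a, E a = 0.
Proof.
move=> derE E0 Ei a; have [p ap] := pf_polynomial a.
suff H : forall p : {mpoly k[n]}, exists2 b : polyfun X,
    (forall x, b x = p.@[pt x 0]) & E b = 0.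
  have [b bp <-] := H p; congr E; apply: polyfunP => x.
  by rewrite ap bp.
apply: mpoly_ring_ind => [c|i|q q' [b bq Eb] [b' bq' Eb']
    |q q' [b bq Eb] [b' bq' Eb']].
- by exists (cst c) => // x; rewrite mevalC.
- by exists (coord i) => // x; rewrite mevalXU.
- exists (b + b'); last by rewrite derE.1 Eb Eb' addr0.
  by move=> x; rewrite mevalD pfE bq bq'.
- exists (b * b'); last by rewrite derE.2 Eb Eb' mul0r mulr0 addr0.
  by move=> x; rewrite mevalM pfE bq bq'.
Qed.

Section CommutativeUnipotent.
Hypothesis X_irr : irreducible X.
Variable U : set (X -> X).
Hypothesis U_unip : unipotent_subgroup U.
Hypothesis U_comm : commutative_set U.

Let integral := polyfun_integral X_irr.
Let nontrivial := polyfun_nontrivial X_irr.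
Let torsion_free := polyfun_torsion_free (X := X) k_char0.

(** A derivation is determined by its values on the [n] coordinates, so the generators have rank at
    most [n] over the fraction field. The rows of a maximal minor span all of them, and what these
    rows kill is killed by every generator. *)
Lemma generating_one_params : exists r (R : 'I_r -> gact X),
  (forall i, one_param U (R i)) /\
  (forall a, (forall i, gen (R i) a = 0) -> invariant U a).
Proof.
pose f (rho : {rho : gact X | one_param U rho}) (j : 'I_n) :=
  gen (sval rho) (coord j).
have [] := maximal_minor nontrivial integral (f := f) (n := n).
  move=> r I J; rewrite leqNgt; apply: contraNN => rn; apply/eqP.
  have /injectivePn[i [i' ii' Jii']] : ~~ injectiveb J.
    by apply/injectiveP => /leq_card; rewrite !card_ord leqNgt rn.
  rewrite -det_tr; apply: (determinant_alternate ii') => j.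
  by rewrite !mxE Jii'.
move=> r [I [J [q0 qf]]]; exists r, (fun i => sval (I i)); split.
  by move=> i; apply: svalP (I i).
move=> a aR u Uu; have [rho <- rhoU] := one_param_exists U_unip Uu.
move=> x; apply: (proj1 (gen_eq0 k_char0 rho a)).
set q := \det _ in q0 qf.
pose c i := \sum_b f (exist _ rho rhoU) (J b) * (\adj (minor f I J)) b i.
pose E b := q * gen rho b - \sum_i c i * gen (sval (I i)) b.
have derE : derivation E.
  have H (sigma : gact X) := gen_derivation k_char0 sigma.
  split=> b b'; rewrite /E.
    rewrite (H _).1.
    have -> : \sum_i c i * gen (sval (I i)) (b + b') =
        \sum_i c i * gen (sval (I i)) b + \sum_i c i * gen (sval (I i)) b'.
      by rewrite -big_split; apply: eq_bigr => i _; rewrite (H _).1 mulrDr.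
    by ring.
  have -> : \sum_i c i * gen (sval (I i)) (b * b') =
     (\sum_i c i * gen (sval (I i)) b) * b' + b * \sum_i c i * gen (sval (I i)) b'.
    rewrite mulr_suml mulr_sumr -big_split; apply: eq_bigr => i _ /=.
    by rewrite (H _).2; ring.
  by rewrite (H _).2; ring.
have E0 : forall b, E b = 0.
  apply: derivation_eq0 => // [b|i]; rewrite /E.
    rewrite (gen_cst k_char0) mulr0 big1 ?subr0 // => i _.
    by rewrite (gen_cst k_char0) mulr0.
  by apply/eqP; rewrite subr_eq0; apply/eqP; apply: (qf (exist _ rho rhoU) i).
apply: (cancel_nonzero integral q0).
by have := E0 a; rewrite /E big1 ?subr0 // => i _; rewrite aR mulr0.
Qed.

Lemma one_param_gen_invariant rho a :
  one_param U rho -> invariant U a -> gen rho a = 0.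
Proof. by move=> rhoU ia; apply/(gen_eq0 k_char0) => s x; apply: ia. Qed.

Lemma slices_one_params : exists m (R : 'I_m -> gact X)
    (s : 'I_m -> polyfun X) (q : polyfun X),
  [/\ q != 0, invariant U q, forall i, one_param U (R i),
    forall i j, gen (R i) (s j) = q *+ (i == j) &
    forall E, derivation E ->
      (forall rho a, one_param U rho -> E (gen rho a) = gen rho (E a)) ->
      (forall a, invariant U a -> E a = 0) ->
      (forall j, invariant U (E (s j))) /\
      forall a, q * E a = \sum_j E (s j) * gen (R j) a].
Proof.
have [r [R [RU Rinv]]] := generating_one_params.
have comR i j a : gen (R i) (gen (R j) a) = gen (R j) (gen (R i) a).
  by apply: (gen_commute k_char0); apply: (one_param_commuting U_comm).
have [m [I [s [q [q0 qc sq Rs qE]]]]] := slices nontrivial integral torsion_free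
  (fun i => gen_derivation k_char0 (R i)) comR
  (fun i => gen_nilpotent k_char0 (R i)).
exists m, (fun i => R (I i)), s, q; split=> //; first exact: Rinv.
move=> E derE comE E0; split=> [j|]; last first.
  by apply: qE => // [i a|a /Rinv/E0 //]; apply: comE.
(* [E] commutes with [gen (R i)], and the derivatives of the slices are invariant, hence killed by
   [E]. *)
apply: (Rinv) => i; rewrite -comE //; by apply: E0; apply/Rinv/Rs.
Qed.

(** * The group C(U): commutative, unipotent and closed *)

Definition cent : set (X -> X) := [set h | [/\ Aut h,
  forall a, invariant U a -> forall x, a (h x) = a x &
  forall u, U u -> forall x, h (u x) = u (h x)]]%classic.

Lemma cent_aut_subgroup : aut_subgroup cent.
Proof.
have mor_id := @morphism_id k n X.
split=> [h []//||f g [fA fi fc] [gA gi gc]|f g [fA fi fc] fg gf].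
- by split=> //; split=> //; exists id.
- split=> [|a ia x|u Uu x] /=.
  + case: fA gA => mf [f' [mf' ff' f'f]] [mg [g' [mg' gg' g'g]]].
    split; first exact: morphism_comp.
    exists (g' \o f'); split; first exact: morphism_comp.
      by move=> x /=; rewrite ff' gg'.
    by move=> x /=; rewrite g'g f'f.
  + by rewrite fi // gi.
  + by rewrite gc // fc.
- split=> [|a ia x|u Uu x].
  + case: fA => mf [f' [mf' ff' f'f]].
    have <- : f' = g by apply/funext => x; rewrite -{1}[x]gf ff'.
    by split=> //; exists f.
  + by rewrite -(fi _ ia) gf.
  + by rewrite -{1}[x]gf -fc // fg.
Qed.

Lemma cent_contains : (U `<=` cent)%classic.
Proof.
move=> u Uu; case: U_unip => -[UA _ _ _] _ _; split; first exact: UA.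
  by move=> a ia x; apply: ia.
by move=> v Uv x; have /(congr1 (@^~ x)) := U_comm Uu Uv.
Qed.

Lemma binomial_poly j :
  exists p : {poly k}, forall m : nat, p.[m%:R] = 'C(m, j)%:R.
Proof.
elim: j => [|j [p pj]]; first by exists 1 => m; rewrite bin0 hornerC.
exists (j.+1%:R^-1 *: (('X - j%:R%:P) * p)) => m.
rewrite hornerZ hornerM pj hornerD hornerN hornerX hornerC.
apply: (mulfI (natr_neq0 k_char0 j)); rewrite mulVKf ?natr_neq0 //.
(* The subtraction in [mul_bin_left] is truncated; for [m < j] the binomial coefficient vanishes
   anyway. *)
rewrite -natrM mul_bin_left natrM; case: (leqP j m) => jm.
  by rewrite natrB.
by rewrite bin_small // !mulr0.
Qed.

(** The difference operator [N] kills invariants and commutes with the generators, so it lowers the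
    filtration and is locally nilpotent. Newton's formula then makes the iterates of [h] polynomial
    in their number, and [interpolation] applies. *)
Lemma cent_one_param h : cent h ->
  exists2 rho : gact X, (rho 1 : X -> X) = h & one_param cent rho.
Proof.
move=> [[mh hA] hi hc].
pose N a := pull h a - a.
have NE a x : N a x = a (h x) - a x by rewrite /N pfE pullE ?pfE.
have [r [R [RU Rinv]]] := generating_one_params.
have comR i j a : gen (R i) (gen (R j) a) = gen (R j) (gen (R i) a).
  by apply: (gen_commute k_char0); apply: (one_param_commuting U_comm).
pose F := filt (fun i => gen (R i)).
have FN d a : F d a -> iter d N a = 0.
  elim: d a => [//|d IH] a Fa; rewrite iterSr; apply: IH.
  elim: d a Fa => [|d IH] a Fa.
    by apply: polyfunP => x; rewrite NE (hi a) ?subrr //; apply: Rinv.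
  move=> i; have := IH _ (Fa i); congr filt.
  rewrite /N (derB (gen_derivation k_char0 (R i))) (gen_pull k_char0) //.
  by move=> s x; rewrite hc //; apply: RU.
(* Newton's forward difference formula, by Pascal's rule. *)
have iterh a d m x : iter d N a = 0 ->
    a (iter m h x) = \sum_(j < d) 'C(m, j)%:R * iter j N a x.
  move=> aN; elim: m x => [|m IH] x.
    case: d aN => [|d] aN; first by rewrite big_ord0 (aN : a = 0).
    rewrite big_ord_recl bin0 mul1r big1 ?addr0 // => j _.
    by rewrite bin0n mul0r.
  rewrite iterSr IH; case: d aN {IH} => [|d] aN; first by rewrite !big_ord0.
  have hN (b : polyfun X) y : b (h y) = b y + N b y by rewrite NE addrC subrK.
  transitivity (\sum_(j < d.+1) 'C(m, j)%:R * iter j N a x +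
      \sum_(j < d.+1) 'C(m, j)%:R * iter j.+1 N a x).
    rewrite -big_split; apply: eq_bigr => j _.
    by rewrite hN mulrDr.
  have recr (G : 'I_d.+1 -> k) : \sum_j G j =
      \sum_(j < d) G (widen_ord (leqnSn d) j) + G ord_max by exact: big_ord_recr.
  rewrite [RHS]big_ord_recl big_ord_recl recr.
  rewrite (aN : iter (@ord_max d).+1 N a = 0).
  rewrite pf0E mulr0 addr0 !bin0 -addrA -big_split; congr (_ + _).
  apply: eq_bigr => j _.
  transitivity ('C(m, j.+1)%:R * iter j.+1 N a x + 'C(m, j)%:R * iter j.+1 N a x).
    by [].
  by rewrite -mulrDl -natrD -binS.
have /choice[d dN] : forall i, exists d, iter d N (coord i) = 0.
  move=> i; have [d /FN] := filt_exhausts (fun i => gen_derivation k_char0 (R i))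
    comR (fun i => gen_nilpotent k_char0 (R i)) (coord i).
  by exists d.
have /choice[p pE] := binomial_poly.
have [|m x i|rho rhoh] := @interpolation h
    (fun i x => \sum_(j < d i) (iter j N (coord i) x)%:P * p j).
- move=> i; apply: poly_family_sum => j; apply: poly_family_mul.
    exact/poly_family_polyC/pf_polynomial.
  exact: poly_family_const.
- rewrite -coordE (iterh _ _ _ _ (dN i)) horner_sum; apply: eq_bigr => j _.
  by rewrite hornerM hornerC pE mulrC.
(* An identity along the iterates of [h] extends to the whole orbit; both conditions of [cent] are
   transferred in this way. *)
have rhon (a b : polyfun X) x : (forall m, a (iter m h x) = b (iter m h x)) ->
    forall s, a (rho s x) = b (rho s x).
  move=> ab s; rewrite !orbE; congr (_.[s]); apply: (poly_eq_nat k_char0) => m.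
  by rewrite -!orbE rhoh.
exists rho; first by apply/funext => x; apply: (rhoh 1%N).
move=> s; split; first exact: gact_Aut.
  move=> a ia x; rewrite (rhon a (cst (a x))) // => m.
  by rewrite cstE; elim: m => //= m <-; apply: hi.
move=> u Uu x; have mu : morphism u by case: U_unip => -[/(_ _ Uu)[]].
apply: pt_inj => i; rewrite -!coordE -(pullE _ _ mu) !orbE; congr (_.[s]).
apply: (poly_eq_nat k_char0) => m; rewrite -!orbE !rhoh pullE //; congr (coord i _).
by elim: m => //= m ->; apply: hc.
Qed.

Lemma cent_unipotent u : cent u -> unipotent_elt u.
Proof.
move=> /cent_one_param[rho <- _]; exists rho, 1; split=> //.
exact: ga_action.
Qed.

(** Let [h] be [rho 1]. In the slice formula for [gen rho] the coefficients are invariant, hence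
    fixed by [g], and [g] commutes with the [R j]. So [pull g] commutes with [gen rho], and by
    Taylor's formula [g] commutes with [rho]. *)
Lemma cent_commutative : commutative_set cent.
Proof.
move=> h g ch cg; have [rho <- rhoC] := cent_one_param ch.
have [m [R [s [q [q0 qc RU sq qE]]]]] := slices_one_params.
have [[mg _] gi gc] := cg.
have grR i t x : R i t (g x) = g (R i t x) by rewrite gc //; apply: RU.
have comE sigma a : one_param U sigma -> gen rho (gen sigma a) = gen sigma (gen rho a).
  move=> sU; apply: (gen_commute k_char0) => t t' x.
  by have [_ _ ->] := rhoC t.
have E0 a : invariant U a -> gen rho a = 0.
  by move=> ia; apply/(gen_eq0 k_char0) => t x; have [_ ->] := rhoC t.
have [cE qE'] := qE _ (gen_derivation k_char0 rho) comE E0.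
have comg a : pull g (gen rho a) = gen rho (pull g a).
  apply/eqP; rewrite -subr_eq0; apply/eqP; apply: (cancel_nonzero integral q0).
  rewrite mulrBr qE'; apply/eqP; rewrite subr_eq0; apply/eqP; apply: polyfunP => x.
  rewrite pfME pullE // -(gi _ qc) -pfME qE' !pf_sumE; apply: eq_bigr => j _.
  by rewrite !pfME gi // (gen_pull k_char0) // pullE.
apply/funext => x; apply: pt_inj => i /=; rewrite -!coordE -(pullE _ _ mg) !orbE.
congr (_.[_]); apply: (orb_eq_iter k_char0) => j; rewrite -(pullE _ _ mg).
congr (pf_fun _ x); elim: j => //= j <-.
by rewrite comg.
Qed.

Lemma cent_closed : aut_closed cent.
Proof.
(* Polynomial representatives let the conditions be evaluated at points of affine space outside
   [X]. *)
pose rep (a : polyfun X) := sval (cid (pf_polynomial a)).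
have repE (a : polyfun X) x : a x = (rep a).@[pt x 0] by rewrite /rep; case: cid.
apply: (aut_closed_criterion (Psi := fun v =>
  (forall (a : {a | invariant U a}) x, (rep (sval a)).@[v x 0] = sval a x) /\
  (forall (u : {u | U u}) x,
    v (sval u x) = \row_i (rep (pull (sval u) (coord i))).@[v x 0]))).
  move=> f g mf mg fg gf; split=> [[_ fi fc]|[fi fc]].
    split=> [[a ia] x|[u Uu] x] /=; first by rewrite -repE fi.
    have mu : morphism u by case: U_unip => -[/(_ _ Uu)[]].
    by apply/rowP => i; rewrite mxE -repE pullE // fc.
  split=> [|a ia x|u Uu x]; first by split=> //; exists g.
    by rewrite repE (fi (exist _ a ia)).
  have mu : morphism u by case: U_unip => -[/(_ _ Uu)[]].
  apply: val_inj; rewrite [LHS](fc (exist _ u Uu)) /=.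
  by apply/rowP => i; rewrite mxE -repE pullE.
move=> d l C pC; have pP (x : X) i : polynomial id (fun c =>
    poly_map (poly_of_coef (C c)) (pt x) 0 i).
  by apply: polynomial_poly_of_coef => // j; apply: polynomial_const.
apply: zclosed_and.
  apply: zclosed_forall => a; apply: zclosed_forall => x.
  apply: zclosed_eq; last exact: polynomial_const.
  exact: polynomial_meval _ (pP x).
apply: zclosed_forall => u; apply: zclosed_forall => x.
apply: zclosed_eq_row => // i.
apply: (polynomial_ext (F := fun c => (rep (pull (sval u) (coord i))).@[
   fun j => poly_map (poly_of_coef (C c)) (pt x) 0 j])).
  by move=> c; rewrite mxE.
exact: polynomial_meval _ (pP x).
Qed.

Lemma cent_unipotent_subgroup : unipotent_subgroup cent.
Proof.
split; [exact: cent_aut_subgroup | exact: cent_closed | exact: cent_unipotent].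
Qed.

End CommutativeUnipotent.
End Centralizers.

(** * Rational functions and birational maps *)

Section GenericEquality.
Context {k : closedFieldType} {n : nat} {X : set 'rV[k]_n}.
Hypothesis X_irr : irreducible X.
Local Open Scope classical_set_scope.
Implicit Types (D E : set X) (a b p q : polyfun X).

Let mul_neq0 := polyfun_mul_neq0 X_irr.

(** The nonvanishing loci of regular functions form a basis of the topology. *)
Lemma zopenP D : zopen D <->
  forall x, D x -> exists2 a : polyfun X, a x != 0 & forall y, a y != 0 -> D y.
Proof.
split=> [[Z [S ->] ->] x /= /existsNP[p /not_implyP[Sp px]]|DP].
  exists (PolyFun (ex_intro _ p (fun y : X => erefl (p.@[(pt y) 0])))).
    exact/eqP.
  by move=> y /eqP py Sy; apply: py; apply: Sy.
(* The complement of [D] is cut out by all polynomials whose nonvanishing locus on [X] lies in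
   [D]. *)
exists (zeros [set p | forall y : X, p.@[(pt y) 0] != 0 -> D y]).
  by exists [set p | forall y : X, p.@[(pt y) 0] != 0 -> D y].
apply/seteqP; split=> x.
  move=> /DP[a ax aD] Zx; have [p ap] := pf_polynomial a.
  case/eqP: ax; rewrite ap; apply: Zx => y.
  by rewrite -ap; apply: aD.
move=> /= /existsNP[p /not_implyP[pD px]]; apply: pD; exact/eqP.
Qed.

Lemma zopen_nonvanishing a : zopen [set x | a x != 0].
Proof. by apply/zopenP => x ax; exists a. Qed.

Lemma zopenI D E : zopen D -> zopen E -> zopen (D `&` E).
Proof.
move=> /zopenP DP /zopenP EP; apply/zopenP => x [/DP[a ax aD] /EP[b bx bE]].
exists (a * b); first by rewrite pfE mulf_neq0.
by move=> y; rewrite pfE mulf_eq0 negb_or => /andP[/aD ? /bE].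
Qed.

Lemma zopen_neq0 D : zopen D -> D !=set0 ->
  exists2 a : polyfun X, a != 0 & forall y, a y != 0 -> D y.
Proof.
move=> /zopenP DP [x /DP[a ax aD]]; exists a => //.
by apply: contraNneq ax => ->.
Qed.

Lemma nonvanishing_neq0 a : a != 0 -> [set x | a x != 0] !=set0.
Proof. by move=> /polyfun_neq0[x ax]; exists x. Qed.

Lemma zopen_meet D E : zopen D -> D !=set0 -> zopen E -> E !=set0 ->
  exists2 x, D x & E x.
Proof.
move=> oD nD oE nE; have [a a0 aD] := zopen_neq0 oD nD.
have [b b0 bE] := zopen_neq0 oE nE.
have [x] := polyfun_neq0 (mul_neq0 a0 b0).
by rewrite pfE mulf_eq0 negb_or => /andP[/aD ? /bE]; exists x.
Qed.

Section Geneq.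
Variable T : Type.
Implicit Types f g h : X -> T.

Lemma geneqP f g : geneq f g <->
  exists2 a : polyfun X, a != 0 & forall x, a x != 0 -> f x = g x.
Proof.
split=> [[D [oD nD fg]]|[a a0 fg]].
  by have [a a0 aD] := zopen_neq0 oD nD; exists a => // x /aD/fg.
exists [set x | a x != 0]; split=> //; first exact: zopen_nonvanishing.
exact: nonvanishing_neq0.
Qed.

Lemma geneq_ext f g : f =1 g -> geneq f g.
Proof.
by move=> fg; apply/geneqP; exists 1 => //; apply: polyfun_nontrivial.
Qed.

Lemma geneq_sym f g : geneq f g -> geneq g f.
Proof. by move=> [D [oD nD fg]]; exists D; split=> // x /fg. Qed.

Lemma geneq_trans f g h : geneq f g -> geneq g h -> geneq f h.
Proof.
move=> /geneqP[a a0 fg] /geneqP[b b0 gh]; apply/geneqP.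
exists (a * b); first exact: mul_neq0.
by move=> x; rewrite pfE mulf_eq0 negb_or => /andP[/fg -> /gh].
Qed.

Lemma geneq_comp_l S (phi : T -> S) f g :
  geneq f g -> geneq (fun x => phi (f x)) (fun x => phi (g x)).
Proof. by move=> [D [oD nD fg]]; exists D; split=> // x /fg ->. Qed.

End Geneq.

Lemma geneq_polyfun a b : geneq (pf_fun a) (pf_fun b) -> a = b.
Proof.
move=> /geneqP[c c0 ab]; apply/eqP; rewrite -subr_eq0; apply/eqP.
apply: (cancel_nonzero (polyfun_integral X_irr) c0); apply: polyfunP => x.
rewrite !pfE; case: (eqVneq (c x) 0) => [->|/ab ->]; first by rewrite mul0r.
by rewrite subrr mulr0.
Qed.

(** Multiplying numerator and denominator by a function that cuts out the neighbourhood turns it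
    into the nonvanishing locus of the denominator. *)
Lemma regular_onP D (f : X -> k) : regular_on D f <->
  forall x, D x -> exists p q : polyfun X,
    q x != 0 /\ forall y, q y != 0 -> D y /\ f y = p y / q y.
Proof.
split=> [fP x /fP[V [p [q [/zopenP Vo Vx VD fV]]]]|fP x /fP[p [q [qx qD]]]].
  have [a ax aV] := Vo _ Vx.
  pose p' : polyfun X := PolyFun (ex_intro _ p (fun y : X => erefl (p.@[(pt y) 0]))).
  pose q' : polyfun X := PolyFun (ex_intro _ q (fun y : X => erefl (q.@[(pt y) 0]))).
  exists (a * p'), (a * q'); split.
    by rewrite pfE mulf_neq0 //; apply: (fV _ Vx).1.
  move=> y; rewrite !pfE mulf_eq0 negb_or => /andP[ay qy]; split.
    exact/VD/aV.
  by rewrite (fV _ (aV _ ay)).2 -mulf_div divff // mul1r.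
have [p' p'E] := pf_polynomial p; have [q' q'E] := pf_polynomial q.
exists [set y | q y != 0], p', q'; split=> //.
- exact: zopen_nonvanishing.
- by move=> y /qD[].
- by move=> y qy; have [_ ->] := qD _ qy; rewrite -p'E -q'E.
Qed.

Lemma regular_on_zopen D f : regular_on D f -> zopen D.
Proof.
move=> /regular_onP fP; apply/zopenP => x /fP[p [q [qx qD]]].
by exists q => // y /qD[].
Qed.

Lemma regular_on_quotient p q :
  regular_on [set x | q x != 0] (fun x => p x / q x).
Proof. by apply/regular_onP => x qx; exists p, q. Qed.

Lemma regular_on_polyfun D a : zopen D -> regular_on D a.
Proof.
move=> /zopenP oD; apply/regular_onP => x /oD[b bx bD].
exists (a * b), b; split=> // y by_; split; first exact: bD.
by rewrite pfE mulfK.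
Qed.

Lemma regular_on_ext D E f g : regular_on D f -> zopen E -> E `<=` D ->
  (forall x, E x -> f x = g x) -> regular_on E g.
Proof.
move=> /regular_onP fP /zopenP oE ED fg; apply/regular_onP => x Ex.
have [p [q [qx qD]]] := fP _ (ED _ Ex); have [a ax aE] := oE _ Ex.
exists (a * p), (a * q); split=> [|y]; first by rewrite pfE mulf_neq0.
rewrite !pfE mulf_eq0 negb_or => /andP[ay qy]; split; first exact: aE.
rewrite -mulf_div divff // mul1r -(fg _ (aE _ ay)); exact: (qD _ qy).2.
Qed.

Lemma regular_on_add D f g :
  regular_on D f -> regular_on D g -> regular_on D (fun x => f x + g x).
Proof.
move=> /regular_onP fP /regular_onP gP; apply/regular_onP => x Dx.
have [p [q [qx qD]]] := fP _ Dx; have [p' [q' [qx' qD']]] := gP _ Dx.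
exists (p * q' + p' * q), (q * q'); split; first by rewrite pfE mulf_neq0.
move=> y; rewrite !pfE mulf_eq0 negb_or => /andP[/[dup] qy /qD[Dy ->]].
by move=> /[dup] qy' /qD'[_ ->]; split=> //; rewrite addf_div.
Qed.

Lemma regular_on_mul D f g :
  regular_on D f -> regular_on D g -> regular_on D (fun x => f x * g x).
Proof.
move=> /regular_onP fP /regular_onP gP; apply/regular_onP => x Dx.
have [p [q [qx qD]]] := fP _ Dx; have [p' [q' [qx' qD']]] := gP _ Dx.
exists (p * p'), (q * q'); split; first by rewrite pfE mulf_neq0.
move=> y; rewrite !pfE mulf_eq0 negb_or => /andP[/[dup] qy /qD[Dy ->]].
by move=> /[dup] qy' /qD'[_ ->]; split=> //; rewrite mulf_div.
Qed.

Lemma regular_on_exp D f j :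
  regular_on D f -> regular_on D (fun x => f x ^+ j).
Proof.
move=> rf; elim: j => [|j IH].
  by apply: (regular_on_polyfun 1); apply: regular_on_zopen rf.
apply: regular_on_ext (regular_on_mul rf IH) _ _ _ => //.
  exact: regular_on_zopen rf.
by move=> x _; rewrite exprS.
Qed.

Lemma regular_on_sum D (I : Type) (s : seq I) (f : I -> X -> k) : zopen D ->
  (forall i, regular_on D (f i)) -> regular_on D (fun x => \sum_(i <- s) f i x).
Proof.
move=> oD rf; elim: s => [|i s IH].
  apply: regular_on_ext (regular_on_polyfun 0 oD) _ _ _ => // x _.
  by rewrite big_nil.
apply: regular_on_ext (regular_on_add (rf i) IH) _ _ _ => // x _.
by rewrite big_cons.
Qed.

Lemma regular_on_comp_polyfun E (g : X -> X) a :
  zopen E -> regular_map_on E g -> regular_on E (fun x => a (g x)).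
Proof.
move=> oE rg; have [p ap] := pf_polynomial a.
suff : regular_on E (fun x => p.@[(pt (g x)) 0]).
  by move=> rp; apply: (regular_on_ext rp oE) => // x _; rewrite ap.
move: p {ap}; apply: mpoly_ring_ind => [c|i|p q rp rq|p q rp rq].
- apply: regular_on_ext (regular_on_polyfun (cst c) oE) _ _ _ => // x _.
  by rewrite mevalC.
- by apply: regular_on_ext (rg i) _ _ _ => // x _; rewrite mevalXU.
- by apply: regular_on_ext (regular_on_add rp rq) _ _ _ => // x _; rewrite mevalD.
- by apply: regular_on_ext (regular_on_mul rp rq) _ _ _ => // x _; rewrite mevalM.
Qed.

Lemma regular_on_comp D E (g : X -> X) f :
  zopen E -> regular_map_on E g -> regular_on D f ->
  regular_on [set x | E x /\ D (g x)] (fun x => f (g x)).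
Proof.
move=> oE rg /regular_onP fP; apply/regular_onP => x [Ex /fP[p [q [qx qD]]]].
have /regular_onP/(_ _ Ex)[p1 [p2 [p2x p2E]]] := regular_on_comp_polyfun p oE rg.
have /regular_onP/(_ _ Ex)[q1 [q2 [q2x q2E]]] := regular_on_comp_polyfun q oE rg.
(* The quotient is [p1 * q2] over [p2 * q1]; the extra factor [q2] keeps the denominator of
   [q (g y)] nonzero on the neighbourhood. *)
exists (p1 * q2 * q2), (p2 * q1 * q2); split=> [|y].
  rewrite !pfE !mulf_neq0 //; apply: contraNneq qx => q1x.
  by rewrite (q2E _ q2x).2 q1x mul0r.
rewrite !pfE !mulf_eq0 !negb_or => /andP[/andP[p2y q1y] q2y].
have [Ey pg] := p2E _ p2y; have [_ qg] := q2E _ q2y.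
have qgy : q (g y) != 0 by rewrite qg mulf_neq0 // invr_eq0.
have [Dgy ->] := qD _ qgy; split=> //; rewrite pg qg.
by field; rewrite p2y q1y q2y.
Qed.

Lemma zopen_preim D E (g : X -> X) : zopen E -> regular_map_on E g -> zopen D ->
  zopen [set x | E x /\ D (g x)].
Proof.
move=> oE rg oD.
exact: regular_on_zopen (regular_on_comp oE rg (regular_on_polyfun 0 oD)).
Qed.

Lemma rational_funP (f : X -> k) : rational_fun f ->
  exists p q : polyfun X, q != 0 /\ forall x, q x != 0 -> f x = p x / q x.
Proof.
move=> [D [_ [x Dx] /regular_onP/(_ _ Dx)[p [q [qx qD]]]]]; exists p, q; split.
  by apply: contraNneq qx => ->.
by move=> y /qD[].
Qed.

Lemma rational_quotient p q : q != 0 -> rational_fun (fun x => p x / q x).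
Proof.
move=> q0; exists [set x | q x != 0]; split; first exact: zopen_nonvanishing.
  exact: nonvanishing_neq0.
exact: regular_on_quotient.
Qed.

(** * Birational maps *)

Lemma Aut_birational (f : X -> X) : Aut f -> birational f.
Proof.
have oT : zopen [set: X].
  by apply/zopenP => x _; exists 1 => //; rewrite pfE oner_eq0.
have nT : [set: X] !=set0.
  have [x] := polyfun_neq0 (polyfun_nontrivial X_irr); by exists x.
have reg (g : X -> X) : morphism g -> regular_map_on [set: X] g.
  move=> mg i; apply: (regular_on_ext (regular_on_polyfun (pull g (coord i)) oT)) => //.
  by move=> x _; rewrite pullE.
by move=> [mf [g [mg fg gf]]]; exists setT, setT, g; split=> //; split;
  by [move=> x; split | apply: reg].
Qed.

Lemma birational_comp (f g : X -> X) :
  birational f -> birational g -> birational (f \o g).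
Proof.
move=> [Df [Ef [f' [[oDf nDf] [oEf nEf] ff' f'f [rf rf']]]]].
move=> [Dg [Eg [g' [[oDg nDg] [oEg nEg] gg' g'g [rg rg']]]]].
exists [set x | Dg x /\ Df (g x)], [set y | Ef y /\ Eg (f' y)], (g' \o f').
have [z Dz Ez] := zopen_meet oDf nDf oEg nEg.
split.
- split; first exact: zopen_preim.
  by exists (g' z); have [? gz] := g'g _ Ez; split=> //; rewrite gz.
- split; first exact: zopen_preim.
  by exists (f z); have [? fz] := ff' _ Dz; split=> //; rewrite fz.
- move=> x [Dx Dgx] /=; have [Efx f'fx] := ff' _ Dgx; rewrite f'fx.
  by have [Egx g'gx] := gg' _ Dx.
- move=> y [Ey Efy] /=; have [Dgy g'gy] := g'g _ Efy; rewrite g'gy.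
  by have [? ?] := f'f _ Ey.
- split=> i; first exact: regular_on_comp oDg rg (rf i).
  exact: regular_on_comp oEf rf' (rg' i).
Qed.

Lemma birational_geneq (f g : X -> X) :
  birational f -> geneq f g -> birational g.
Proof.
move=> [D [E [f' [[oD nD] [oE nE] ff' f'f [rf rf']]]]] /geneqP[a a0 fg].
have oa := zopen_nonvanishing a.
have oDa := zopenI oD oa; have oEa := zopen_preim oE rf' oa.
exists (D `&` [set x | a x != 0]), [set y | E y /\ a (f' y) != 0], f'.
have [z Dz az] := zopen_meet oD nD oa (nonvanishing_neq0 a0).
split.
- by split=> //; exists z.
- by split=> //; exists (f z); have [? fz] := ff' _ Dz; split=> //=; rewrite fz.
- move=> x [Dx ax]; rewrite -fg //; have [Efx f'fx] := ff' _ Dx.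
  by do 2 split=> //=; rewrite f'fx.
- by move=> y [Ey ay]; have [Dy fy] := f'f _ Ey; rewrite -fg.
- split=> i; last by apply: regular_on_ext (rf' i) _ _ _ => // x [].
  by apply: regular_on_ext (rf i) _ _ _ => // x [] // _ ax; rewrite fg.
Qed.

(** A birational [g] is dominant: its image contains the nonempty open set [Eg], which meets the set
    where [f] and [f'] agree. *)
Lemma geneq_comp_birational T (f f' : X -> T) (g : X -> X) :
  geneq f f' -> birational g -> geneq (fun x => f (g x)) (fun x => f' (g x)).
Proof.
move=> [D [oD nD ff']] [Dg [Eg [g' [[oDg nDg] [oEg nEg] gg' g'g [rg rg']]]]].
have [z Dz Ez] := zopen_meet oD nD oEg nEg.
exists [set x | Dg x /\ D (g x)]; split; first exact: zopen_preim.
  by exists (g' z); have [? gz] := g'g _ Ez; split=> //; rewrite gz.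
by move=> x [_ /ff'].
Qed.

End GenericEquality.

(** * Replicas *)

Section Replicas.
Context {k : closedFieldType} (k_char0 : [pchar k] =i pred0).
Context {n : nat} {X : set 'rV[k]_n} (X_closed : zclosed X).
Hypothesis X_irr : irreducible X.

(** * Products of commuting additive actions *)

Section Products.
Variables (m : nat) (R : 'I_m -> gact X).
Hypothesis comR : forall i j, commuting (R i) (R j).

Definition prod_act (l : seq 'I_m) (t : 'I_m -> k) : X -> X :=
  foldr (fun i f => R i (t i) \o f) id l.

Lemma prod_act_comm l t (f : X -> X) :
  (forall i s x, R i s (f x) = f (R i s x)) ->
  forall x, prod_act l t (f x) = f (prod_act l t x).
Proof. by move=> cf x; elim: l => //= i l ->; rewrite cf. Qed.

Lemma prod_act_closed (U : set (X -> X)) l t :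
  aut_subgroup U -> (forall i, one_param U (R i)) -> U (prod_act l t).
Proof.
by move=> [_ U1 UM _] RU; elim: l => //= i l IH; apply: UM => //; apply: RU.
Qed.

Lemma prod_actD l t t' x :
  prod_act l (fun i => t i + t' i) x = prod_act l t (prod_act l t' x).
Proof.
elim: l => //= i l ->; rewrite gactD; congr (R i _ _).
by rewrite -prod_act_comm // => j s y; apply: comR.
Qed.

Lemma prod_act0 l x : prod_act l (fun=> 0) x = x.
Proof. by elim: l => //= i l ->; rewrite gact0. Qed.

Lemma prod_act_gact l c : exists rho : gact X,
  (forall t, (rho t : X -> X) = prod_act l (fun i => t * c i)) /\
  forall b, gen rho b = \sum_(i <- l) cst (c i) * gen (R i) b.
Proof.
elim: l => [|i l [rho [rhoE rhog]]].
  exists (gact_id (X := X)); split=> [t|b]; first exact/funext.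
  by rewrite gen_id // big_nil.
have cir : commuting (gact_scale (c i) (R i)) rho.
  move=> s t x; rewrite rhoE /= -prod_act_comm // => j s' y.
  exact: comR.
exists (gact_comp cir); split=> [t|b].
  by apply/funext => x; rewrite /= rhoE mulrC.
by rewrite gen_comp // gen_scale // rhog big_cons.
Qed.

Lemma prod_act_invariant l t (a : polyfun X) :
  (forall i, gen (R i) a = 0) -> forall x, a (prod_act l t x) = a x.
Proof.
move=> aR x; elim: l => //= i l IH.
by rewrite (proj1 (gen_eq0 k_char0 (R i) a)).
Qed.

End Products.

(** * Elements of C(U) as products of replicas *)

Section LowerBound.
Variable U : set (X -> X).
Hypothesis U_unip : unipotent_subgroup U.
Hypothesis U_comm : commutative_set U.

Let integral := polyfun_integral X_irr.

(* Where [q <> 0], the vector fields [gen rho] and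
   [sum_j (p_j x / q x) gen (R j)] agree at [x] to all orders. *)
Lemma cent_generic_form h : cent U h ->
  exists m (R : 'I_m -> gact X) (p : 'I_m -> polyfun X) (q : polyfun X),
  [/\ q != 0, invariant U q /\ (forall j, invariant U (p j)),
    forall i, one_param U (R i), forall i, (R i 1 : X -> X) <> id &
    forall x, q x != 0 -> h x = prod_act R (enum 'I_m) (fun j => p j x / q x) x].
Proof.
move=> ch; have [rho <- rhoC] := cent_one_param k_char0 X_closed X_irr U_unip U_comm ch.
have [m [R [s [q [q0 qc RU sq qE]]]]] :=
  slices_one_params k_char0 X_irr U_unip U_comm.
have comE sigma a : one_param U sigma -> gen rho (gen sigma a) = gen sigma (gen rho a).
  move=> sU; apply: (gen_commute k_char0) => t t' x.
  by have [_ _ ->] := rhoC t.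
have E0 a : invariant U a -> gen rho a = 0.
  by move=> ia; apply/(gen_eq0 k_char0) => t x; have [_ ->] := rhoC t.
have [cE qE'] := qE _ (gen_derivation k_char0 rho) comE E0.
have comR i j : commuting (R i) (R j) by apply: (one_param_commuting U_comm).
exists m, R, (fun j => gen rho (s j)), q; split=> //.
  (* If [R i 1] were the identity, [s i] would be constant at natural times, hence along orbits, and
     [q = gen (R i) (s i)] would vanish. *)
  move=> i Ri; move/eqP: q0; apply.
  have := sq i i; rewrite eqxx mulr1n => <-.
  apply: polyfunP => x; rewrite genE.
  suff -> : orb (R i) (s i) x = (s i x)%:P by rewrite coefC.
  apply: (poly_eq_nat k_char0) => j; rewrite hornerC -orbE; congr (s i _).
  elim: j => [|j IH]; first by rewrite gact0.
  by rewrite -natr1 gactD Ri.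
(* Freezing the coefficients at [x] gives an honest action [sigma] to compare with [rho]. *)
move=> x qx; set c := fun j => gen rho (s j) x / q x.
have [sigma [sE sg]] := prod_act_gact comR (enum 'I_m) c.
have Ex b : gen rho b x = gen sigma b x.
  apply: (mulfI qx); rewrite sg -pfME qE' !pf_sumE mulr_sumr big_enum.
  apply: eq_bigr => j _; rewrite !pfME cstE mulrA /c; congr (_ * _).
  by rewrite mulrCA divff // mulr1.
have comrs b : gen rho (gen sigma b) = gen sigma (gen rho b).
  rewrite !sg (der_sum (gen_derivation k_char0 rho)); apply: eq_bigr => j _.
  by rewrite (gen_cstM k_char0) comE.
(* First-order agreement holds only at [x]. Because the two generators commute, [gen rho] can be
   moved to the outside, where [Ex] applies. *)
have iterE j b : iter j (gen rho) b x = iter j (gen sigma) b x.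
  elim: j b => // j IH b; rewrite iterSr IH [in RHS]iterS -Ex.
  by congr (pf_fun _ x); elim: j {IH} => //= j ->; rewrite comrs.
have -> : prod_act R (enum 'I_m) c x = sigma 1 x.
  by rewrite sE; congr (prod_act _ _ _ _); apply/funext => j; rewrite mul1r.
apply: pt_inj => i; rewrite -!coordE !orbE; congr (_.[_]).
exact: (orb_eq_iter k_char0).
Qed.

(** Each factor in the generic form is a replica, so the product lies in every subgroup of Bir(X)
    containing the replicas, and [h] lies there by saturation. *)
Lemma cent_RX : (cent U `<=` RX U)%classic.
Proof.
move=> h ch; split; first by have [] := ch.
move=> H [Hbir HR]; have [m [R [p [q [q0 [qc pc] RU R1 hE]]]]] := cent_generic_form ch.
have [_ Hgeq H1 HM _] := Hbir.
have [U_group _ _] := U_unip.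
pose F i x := R i (p i x / q x) x.
have HF i : H (F i).
  apply: HR; exists (fun x => p i x / q x), (R i 1); split; last 1 first.
  - right; split; first exact: R1.
    exists (R i); split=> //; first exact: ga_action.
    exact: geneq_ext.
  - split; first exact: rational_quotient.
    by move=> u Uu; apply: geneq_ext => // x /=; rewrite pc // qc.
  - exact: RU.
pose G l := foldr (fun i f => F i \o f) id l.
have HG l : H (G l) by elim: l => //= i l IH; apply: HM.
(* The coefficients of each replica are invariant, so they may be evaluated at the original point
   [x] and not at its image. *)
have GE l x : G l x = prod_act R l (fun j => p j x / q x) x.
  elim: l => //= i l ->; rewrite /F.
  have Ul := prod_act_closed l (fun j => p j x / q x) U_group RU.
  by rewrite pc // qc.
apply: Hgeq (HG (enum 'I_m)) _; apply/geneqP.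
by exists q => // x /hE ->; rewrite GE.
Qed.

End LowerBound.

(** * Replicas generically commute with U and fix its invariants *)

Section UpperBound.
Variable U : set (X -> X).
Hypothesis U_unip : unipotent_subgroup U.
Hypothesis U_comm : commutative_set U.

Let integral := polyfun_integral X_irr.

(** Invariance of [p / q] gives [D^j p * q = p * D^j q] for all [j], where [D] is [gen rho]. Hence
    [p / q] is also the quotient of [D^j p] by [D^j q]; for the last [j] with [D^j q] nonzero, both
    are killed by [D]. *)
Lemma rational_invariant_quotient (rho : gact X) f : rational_fun f ->
  (forall s, geneq (f \o rho s) f) ->
  exists p q : polyfun X, [/\ q != 0, gen rho p = 0, gen rho q = 0 &
    geneq f (fun x => p x / q x)].
Proof.
move=> /rational_funP[p [q [q0 fE]]] f_inv.
have pq s x : p (rho s x) * q x = p x * q (rho s x).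
  have mr := gact_morphism rho s.
  have q0' : pull (rho s) q != 0.
    have [x' qx'] := polyfun_neq0 q0; apply: contraNneq qx'.
    move=> /(congr1 (fun a => pf_fun a (rho (- s) x'))).
    by rewrite pullE // gactK => ->.
  suff e : pull (rho s) p * q = p * pull (rho s) q.
    by have := congr1 (fun a => pf_fun a x) e; rewrite !pfE !pullE.
  apply: (geneq_polyfun X_irr).
  have [a a0 fa] := proj1 (geneqP _ _) (f_inv s).
  apply/geneqP; exists (a * q * pull (rho s) q).
    by rewrite !(polyfun_mul_neq0 X_irr).
  move=> y; rewrite !pfE !mulf_eq0 !negb_or !pullE // => /andP[/andP[ay qy] qry].
  have := fa y ay; rewrite /= !fE // => e.
  by apply/eqP; rewrite -eqr_div // e.
have opq x : orb rho p x * (q x)%:P = (p x)%:P * orb rho q x.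
  by apply: (poly_eq_nat k_char0) => j; rewrite !hornerM !hornerC -!orbE.
have ipq j : iter j (gen rho) p * q = p * iter j (gen rho) q.
  apply: polyfunP => x; rewrite !pfME !iter_genE // mulrnAl mulrnAr.
  have := congr1 (fun r : {poly k} => r`_j) (opq x).
  by rewrite coefMC coefCM => ->.
have exj : exists j, iter j (gen rho) q == 0.
  by have [j qj] := gen_nilpotent k_char0 rho q; exists j; apply/eqP.
case: (ex_minnP exj) => -[|j] /eqP qj minj; first by rewrite (qj : q = 0) eqxx in q0.
exists (iter j (gen rho) p), (iter j (gen rho) q); split=> //.
- by apply: contraT; rewrite negbK => /minj; rewrite ltnn.
- have := ipq j.+1; rewrite qj mulr0 mulrC.
  exact: (cancel_nonzero integral q0).
apply/geneqP; exists (q * iter j (gen rho) q).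
  rewrite (polyfun_mul_neq0 X_irr) //.
  by apply: contraT; rewrite negbK => /minj; rewrite ltnn.
move=> x; rewrite pfE mulf_eq0 negb_or => /andP[qx qjx].
rewrite fE //; apply/eqP; rewrite eqr_div // -!pfME ipq; exact/eqP.
Qed.

(** Since [p] and [q] are constant on orbits, the map preserves the locus where [q] is nonzero, and
    replacing [p] by [- p] inverts it there. *)
Lemma quotient_replica_birational (rho : gact X) (p q : polyfun X) : q != 0 ->
  gen rho p = 0 -> gen rho q = 0 -> birational (fun x => rho (p x / q x) x).
Proof.
move=> q0 /(gen_eq0 k_char0) pc /(gen_eq0 k_char0) qc.
have oq := zopen_nonvanishing q; have nq := nonvanishing_neq0 q0.
have reg (p' : polyfun X) : regular_map_on [set x | q x != 0]%classic
    (fun x => rho (p' x / q x) x).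
  move=> i; have [[N bN] _] := orb_family rho (coord i).
  have rs : regular_on [set x | q x != 0]%classic (fun x =>
      \sum_(j < N) orb_coef rho (coord i) j x * (p' x / q x) ^+ j).
    apply: (regular_on_sum _ oq) => j; apply: regular_on_mul.
      exact: (regular_on_polyfun _ oq).
    exact/regular_on_exp/regular_on_quotient.
  by apply: (regular_on_ext rs oq) => // x _; rewrite -(horner_coef_wide _ (bN x)) -orbE.
exists [set x | q x != 0]%classic, [set x | q x != 0]%classic,
  (fun x => rho ((- p) x / q x) x); split=> //.
- by move=> x qx /=; rewrite !qc pc mulNr gactNK.
- by move=> x qx /=; rewrite !qc pc mulNr gactK.
Qed.

(** The counterpart of [cent] in Bir(X), where composites and inverses are only controlled up to
    [geneq]. *)
Definition generic_cent : set (X -> X) := [set h | [/\ birational h,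
  forall a, invariant U a -> geneq (fun x => a (h x)) a &
  forall u, U u -> geneq (h \o u) (u \o h)]]%classic.

Lemma generic_cent_geneq f g : generic_cent f -> geneq f g -> generic_cent g.
Proof.
move=> [bf fi fc] fg; have gf := geneq_sym fg; split.
- exact: birational_geneq fg.
- move=> a ia; apply: (geneq_trans X_irr) (fi a ia).
  exact: geneq_comp_l gf.
- move=> u Uu; have bu : birational u.
    by apply: (Aut_birational X_irr); case: U_unip => -[/(_ _ Uu)].
  apply: (geneq_trans X_irr) (geneq_comp_birational X_irr gf bu) _.
  apply: (geneq_trans X_irr) (fc u Uu) _.
  exact: geneq_comp_l fg.
Qed.

Lemma generic_cent_bir_subgroup : bir_subgroup generic_cent.
Proof.
have bU u : U u -> birational u.
  by move=> Uu; apply: (Aut_birational X_irr); case: U_unip => -[/(_ _ Uu)].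
have gtr := geneq_trans X_irr.
have gcb := geneq_comp_birational X_irr.
split=> [h []//|f g|||].
- exact: generic_cent_geneq.
- split=> [|a _|u _]; try exact: geneq_ext.
  apply: (Aut_birational X_irr); split; first exact: morphism_id.
  by exists id; split=> //; apply: morphism_id.
- move=> f g [bf fi fc] [bg gi gc]; split; first exact: birational_comp.
    by move=> a ia; apply: gtr (gcb _ _ _ _ (fi a ia) bg) (gi a ia).
  move=> u Uu; apply: gtr (geneq_comp_l f (gc u Uu)) _.
  exact: gcb (fc u Uu) bg.
- move=> f g [bf fi fc] bg fg gf; split=> //.
    move=> a ia; apply: gtr (geneq_sym (gcb _ _ _ _ (fi a ia) bg)) _.
    exact: (geneq_comp_l a fg).
  (* The composite [g f u g] is generically [g u] by [e2], and generically [u g] by [e3]. *)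
  move=> u Uu; have e1 := gcb _ _ _ _ (fc u Uu) bg.
  have e2 := gtr _ _ _ _ (geneq_comp_l g e1) (geneq_comp_l (g \o u) fg).
  have e3 := gcb _ _ _ _ (gcb _ _ _ _ gf (bU u Uu)) bg.
  exact: gtr (geneq_sym e2) e3.
Qed.

(** An action through an element of the closed group [U] stays in [U]. So [rho] fixes the invariants
    and commutes with [U], whatever its time parameter; [f] is made a quotient of [rho]-invariants
    to obtain birationality. *)
Lemma rRepl_generic_cent : (rRepl U `<=` generic_cent)%classic.
Proof.
have [U_group U_closed _] := U_unip.
have [_ _ G1 _ _] := generic_cent_bir_subgroup.
move=> h [f [u [[rf f_inv] Uu]]] [[_ hid]|[_ [r [ga r1 hE]]]].
  exact: generic_cent_geneq G1 (geneq_sym hid).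
pose rho := Gact ga.
have rhoU : one_param U rho.
  by apply: one_param_of_elt => //; rewrite [rho 1]r1.
apply: generic_cent_geneq (geneq_sym hE); split.
- have [p [q [q0 pc qc fpq]]] :=
    rational_invariant_quotient rf (fun s => f_inv _ (rhoU s)).
  apply: birational_geneq (quotient_replica_birational q0 pc qc) _ => //.
  have [a a0 fa] := proj1 (geneqP _ _) fpq.
  by apply/geneqP; exists a => // x /fa ->.
- by move=> a ia; apply: geneq_ext => // x; apply: ia; apply: rhoU.
- move=> v Uv; have [a a0 fa] := proj1 (geneqP _ _) (f_inv v Uv).
  apply/geneqP; exists a => // x /fa /= ->.
  by have /(congr1 (@^~ x)) := U_comm (rhoU (f x)) Uv.
Qed.

(** By minimality the generated group lies in [generic_cent]. For a regular [h] the generic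
    identities hold everywhere, since regular functions that agree generically are equal. *)
Lemma RX_cent : (RX U `<=` cent U)%classic.
Proof.
move=> h [hA /(_ _ (conj generic_cent_bir_subgroup rRepl_generic_cent)) [_ hi hc]].
have [mh _] := hA; split=> // [a ia x|u Uu x].
  rewrite -pullE //; congr (pf_fun _ x); apply: (geneq_polyfun X_irr).
  apply: (geneq_trans X_irr) (hi a ia); apply: geneq_ext => // y.
  by rewrite pullE.
have mu : morphism u by case: U_unip => -[/(_ _ Uu)[]].
apply: pt_inj => i; rewrite -!coordE.
have mhu := morphism_comp mh mu; have muh := morphism_comp mu mh.
have e : pull (h \o u) (coord i) = pull (u \o h) (coord i).
  apply: (geneq_polyfun X_irr).
  apply: (geneq_trans X_irr) (geneq_ext X_irr (fun y => pullE (coord i) y mhu)) _.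
  apply: (geneq_trans X_irr) _
    (geneq_sym (geneq_ext X_irr (fun y => pullE (coord i) y muh))).
  exact: (geneq_comp_l (coord i) (hc u Uu)).
by have := congr1 (fun a => pf_fun a x) e; rewrite !pullE.
Qed.

End UpperBound.

Theorem RX_eq_cent (U : set (X -> X)) : unipotent_subgroup U ->
  commutative_set U -> RX U = cent U.
Proof.
by move=> U_unip U_comm; apply/seteqP; split; [apply: RX_cent | apply: cent_RX].
Qed.

End Replicas.

(** * Maximal commutative subgroups *)

Section Maximality.
Context {k : closedFieldType} (k_char0 : [pchar k] =i pred0).
Context {n : nat} {X : set 'rV[k]_n} (X_closed : zclosed X).
Hypothesis X_irr : irreducible X.

(** * The vector group spanned by the slice directions *)

Section VectorGroup.
Variables (m : nat) (R : 'I_m -> gact X) (s : 'I_m -> polyfun X) (q : polyfun X).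
Hypothesis comR : forall i j, commuting (R i) (R j).
Hypothesis q0 : q != 0.
Hypothesis qR : forall i, gen (R i) q = 0.
Hypothesis sR : forall i j, gen (R i) (s j) = q *+ (i == j).

Definition vec_act (t : 'rV[k]_m) : X -> X := prod_act R (enum 'I_m) (t 0).

Definition vec_group : set (X -> X) := range vec_act.

Lemma vec_actD t t' x : vec_act (t + t') x = vec_act t (vec_act t' x).
Proof.
rewrite /vec_act -(prod_actD comR); congr (prod_act _ _ _ _).
by apply/funext => i; rewrite mxE.
Qed.

Lemma vec_act0 x : vec_act 0 x = x.
Proof.
rewrite -[RHS](prod_act0 R (enum 'I_m)); congr (prod_act _ _ _ _).
by apply/funext => i; rewrite mxE.
Qed.

Lemma vec_actNK t x : vec_act (- t) (vec_act t x) = x.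
Proof. by rewrite -vec_actD addNr vec_act0. Qed.

Definition vec_pt (tx : 'rV[k]_m * X) : 'rV[k]_(m + n) := row_mx tx.1 (pt tx.2).

Lemma vec_act_polynomial i :
  polynomial vec_pt (fun tx => pt (vec_act tx.1 tx.2) 0 i).
Proof.
rewrite /vec_act; elim: (enum 'I_m) i => [|j l IH] i.
  apply: polynomial_ext (polynomial_coord vec_pt (rshift m i)) => tx /=.
  by rewrite row_mxEr.
apply: (polynomial_comp (g := fun tx : 'rV[k]_m * X =>
  (tx.1 0 j, prod_act R l (tx.1 0) tx.2)) (gact_polynomial (R j) i)) => e.
rewrite -(splitK e); case: (split e) => e' /=.
  apply: polynomial_ext (polynomial_coord vec_pt (lshift n j)) => tx.
  by rewrite act_pt_l row_mxEl.
by apply: polynomial_ext (IH e') => tx; rewrite act_pt_r.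
Qed.

Lemma vec_act_gact t : exists rho : gact X,
  (forall c, (rho c : X -> X) = vec_act (c *: t)) /\
  forall b, gen rho b = \sum_i cst (t 0 i) * gen (R i) b.
Proof.
have [rho [rhoE rhog]] := prod_act_gact k_char0 comR (enum 'I_m) (t 0).
exists rho; split=> [c|b]; last by rewrite rhog big_enum.
by rewrite rhoE /vec_act; congr prod_act; apply/funext => i; rewrite mxE.
Qed.

Lemma vec_act_Aut t : Aut (vec_act t).
Proof.
have [rho [rhoE _]] := vec_act_gact t.
by have := gact_Aut rho 1; rewrite rhoE scale1r.
Qed.

Lemma vec_group_aut_subgroup : aut_subgroup vec_group.
Proof.
split=> [_ [t _ <-]||_ _ [t _ <-] [t' _ <-]|_ g [t _ <-] tg gt].
- exact: vec_act_Aut.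
- by exists 0 => //; apply/funext => x; rewrite vec_act0.
- by exists (t + t') => //; apply/funext => x; rewrite vec_actD.
- exists (- t) => //; apply/funext => x.
  by rewrite -{1}[x]gt vec_actNK.
Qed.

Lemma vec_group_commutative : commutative_set vec_group.
Proof.
move=> _ _ [t _ <-] [t' _ <-]; apply/funext => x /=.
by rewrite -!vec_actD addrC.
Qed.

(** Along [R i] the function [s j] is affine in time: its derivative is [q] or 0, which [R i] kills.
    The parameter [t] can thus be read off wherever [q] is nonzero. *)
Lemma slice_act t x j : s j (vec_act t x) = s j x + q x * t 0 j.
Proof.
have sRE i c y : s j (R i c y) = s j y + (q *+ (i == j)) y * c.
  rewrite orbE (_ : orb _ _ _ = (s j y)%:P + ((q *+ (i == j)) y)%:P * 'X).
    by rewrite hornerD hornerM !hornerC hornerX.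
  apply/polyP => -[|[|e]]; rewrite coefD coefC coefMX coefC /=.
  - by rewrite orb_0 addr0.
  - by rewrite add0r -genE sR.
  rewrite addr0; apply: (@mulrn_eq0_char0 _ k_char0 _ e.+2`!).
    exact: fact_gt0.
  rewrite -(iter_genE k_char0) !iterSr sR.
  rewrite (derMn (gen_derivation k_char0 _)) qR mul0rn.
  suff -> : iter e (gen (R i)) 0 = 0 by [].
  by elim: e => //= e ->; apply: (der0 (gen_derivation k_char0 _)).
have -> : t 0 j = \sum_(i <- enum 'I_m) t 0 i *+ (i == j).
  by rewrite big_enum (bigD1 j) //= eqxx mulr1n big1 ?addr0 // => i /negPf ->.
rewrite /vec_act; elim: (enum 'I_m) => [|i l IH] /=.
  by rewrite big_nil mulr0 addr0.
rewrite sRE IH big_cons pfMnE (prod_act_invariant k_char0) // mulrDr.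
by rewrite -addrA; congr (_ + _); rewrite addrC mulrnAr mulrnAl.
Qed.

(** At a point [p] with [q p != 0], [tau] recovers [t] polynomially from the image of [p].
    Membership of [f] therefore means that [f] equals the element with parameter [tau (f p)], a
    polynomial condition. *)
Lemma vec_group_closed : aut_closed vec_group.
Proof.
have [p qp] := polyfun_neq0 q0.
have [M ME] := polynomial_choice vec_act_polynomial.
have /choice[r rE] : forall j, exists r : {mpoly k[n]}, forall x, s j x = r.@[pt x 0].
  by move=> j; apply: pf_polynomial.
pose tau (w : 'rV[k]_n) : 'rV[k]_m := \row_j (((r j).@[w 0] - s j p) * (q p)^-1).
have tauE t : tau (pt (vec_act t p)) = t.
  apply/rowP => j; rewrite mxE -rE slice_act addrC addKr mulrC mulKf //.
apply: (aut_closed_criterion X_closed (Psi := fun v =>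
    forall x, v x = poly_map M (row_mx (tau (v p)) (pt x)))).
  move=> f g _ _ _ _; split=> [[t _ <-] x|fE].
    by rewrite tauE; apply: (ME (t, x)).
  exists (tau (pt (f p))) => //; apply/funext => x; apply: val_inj.
  by rewrite [LHS](ME (tau (pt (f p)), x)) /= -fE.
move=> d l C pC; have pP (x : X) i : polynomial id (fun c =>
    poly_map (poly_of_coef (C c)) (pt x) 0 i).
  by apply: polynomial_poly_of_coef => // j; apply: polynomial_const.
apply: zclosed_forall => x; apply: zclosed_eq_row => // i.
apply: (polynomial_ext (F := fun c => (M i).@[fun e =>
  row_mx (tau (poly_map (poly_of_coef (C c)) (pt p))) (pt x) 0 e])).
  by move=> c; rewrite mxE.
apply: polynomial_meval => e; rewrite -(splitK e); case: (split e) => j /=.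
  apply: (polynomial_ext (F := fun c =>
     ((r j).@[fun e' => poly_map (poly_of_coef (C c)) (pt p) 0 e'] - s j p) * (q p)^-1)).
    by move=> c; rewrite row_mxEl mxE.
  apply: polynomial_mul; last exact: polynomial_const.
  apply: polynomial_sub; last exact: polynomial_const.
  exact: polynomial_meval _ (pP p).
by apply: polynomial_ext (polynomial_const id (pt x 0 j)) => c; rewrite row_mxEr.
Qed.

Lemma vec_group_unipotent : unipotent_subgroup vec_group.
Proof.
split; [exact: vec_group_aut_subgroup | exact: vec_group_closed |].
move=> _ [t _ <-]; have [rho [rhoE _]] := vec_act_gact t.
by exists rho, 1; split; [exact: ga_action | rewrite rhoE scale1r].
Qed.

Lemma vec_group_invariant a : invariant vec_group a -> forall i, gen (R i) a = 0.
Proof.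
move=> ia i; have [rho [rhoE rhog]] := vec_act_gact (delta_mx 0 i).
have : gen rho a = 0.
  by apply/(gen_eq0 k_char0) => c x; rewrite rhoE; apply: ia; exists (c *: delta_mx 0 i).
rewrite rhog (bigD1 i) //= big1 => [|j /negPf ji]; last first.
  by rewrite mxE ji andbF; apply: polyfunP => x; rewrite pfME cstE mul0r.
by rewrite addr0 mxE !eqxx => <-; apply: polyfunP => x; rewrite pfME cstE mul1r.
Qed.

End VectorGroup.

(** * Affine space as an algebraic group acting on X *)

Section AdditiveGroup.
Variable m : nat.
Let V : set 'rV[k]_m := [set: 'rV[k]_m]%classic.
Let mkV (v : 'rV[k]_m) : V := SigSub (mem_set (I : V v)).

Let mkVP (v w : V) : val v = val w -> v = w.
Proof. exact: val_inj. Qed.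

Lemma vector_closed : zclosed V.
Proof. by exists set0; apply/seteqP; split=> // x _ p []. Qed.

Let vadd (v w : V) := mkV (val v + val w).
Let vopp (v : V) := mkV (- val v).

Lemma vector_add_morphism : morphism2 vadd.
Proof.
pose e (vw : V * V) := row_mx (val vw.1) (val vw.2).
have [|P PE] := @polynomial_choice _ _ _ e _ (fun vw => val vw.1 + val vw.2).
  move=> i; apply: polynomial_ext (polynomial_add (polynomial_coord e (lshift m i))
    (polynomial_coord e (rshift m i))) => vw.
  by rewrite row_mxEl row_mxEr mxE.
by exists P => v w; apply: (PE (v, w)).
Qed.

Lemma vector_opp_morphism : morphism vopp.
Proof.
have [|P PE] := @polynomial_choice _ _ _ (fun v : V => val v) _ (fun v => - val v).
  move=> i; apply: polynomial_ext (polynomial_opp (polynomial_coord _ i)) => v.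
  by rewrite mxE.
by exists P.
Qed.

Lemma vector_addA : associative vadd.
Proof. by move=> u v w; apply: mkVP; rewrite /= addrA. Qed.
Lemma vector_add0 : left_id (mkV 0) vadd.
Proof. by move=> v; apply: mkVP; rewrite /= add0r. Qed.
Lemma vector_addN : left_inverse (mkV 0) vopp vadd.
Proof. by move=> v; apply: mkVP; rewrite /= addNr. Qed.

Definition vector_alg_group := AlgGroup vector_closed vector_add_morphism
  vector_opp_morphism vector_addA vector_add0 vector_addN.

Lemma vec_group_alg_subgroup (R : 'I_m -> gact X) :
  (forall i j, commuting (R i) (R j)) -> alg_subgroup (vec_group R).
Proof.
move=> comR; exists vector_alg_group, (fun v : V => vec_act R (val v)); split.
  split.
  - have [P PE] := polynomial_choice (vec_act_polynomial R).
    by exists P => v x; apply: (PE (val v, x)).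
  - by apply/funext => x; apply: vec_act0.
  - by move=> v w; apply/funext => x; apply: vec_actD.
apply/seteqP; split=> [_ [t _ <-]|_ [v _ <-]]; last by exists (val v).
by exists (mkV t).
Qed.

End AdditiveGroup.

(** * Passing between maximality and replicas *)

Lemma maximal_unipotent_is_RX (G : set (X -> X)) :
  maximal_among [set H | unipotent_subgroup H /\ commutative_set H]%classic G ->
  exists U : set (X -> X),
    [/\ alg_subgroup U, unipotent_subgroup U, commutative_set U & G = RX U].
Proof.
move=> [[G_unip G_comm] G_max].
have [m [R [s [q [q0 qc RG sq qE]]]]] :=
  slices_one_params k_char0 X_irr G_unip G_comm.
have comR i j : commuting (R i) (R j) by apply: (one_param_commuting G_comm).
have qR i : gen (R i) q = 0 by apply: (one_param_gen_invariant k_char0 (RG i)).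
have U_unip := vec_group_unipotent comR q0 qR sq.
have U_comm := vec_group_commutative comR.
exists (vec_group R); split=> //; first exact: vec_group_alg_subgroup.
rewrite (RX_eq_cent k_char0 X_closed X_irr U_unip U_comm); apply/esym/G_max.
  split; first exact: cent_unipotent_subgroup.
  exact: cent_commutative.
have [G_group _ _] := G_unip.
move=> g Gg; split; first by case: G_group => GA _ _ _; apply: GA.
  move=> a ia x; have [rho <- rhoG] := one_param_exists k_char0 G_unip Gg.
  apply: (proj1 (gen_eq0 k_char0 rho a)).
  (* An invariant of the vector group is killed by all [gen (R j)], so the slice formula for
     [gen rho] gives [q * gen rho a = 0]. *)
  apply: (cancel_nonzero (polyfun_integral X_irr) q0).
  have [|b ib|_ ->] := qE _ (gen_derivation k_char0 rho).
  - move=> sigma b sG; apply: (gen_commute k_char0).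
    exact: (one_param_commuting G_comm).
  - exact: (one_param_gen_invariant k_char0 rhoG).
  rewrite big1 // => j _.
  by rewrite (vec_group_invariant comR ia) mulr0.
move=> _ [t _ <-] x.
have Gt : G (vec_act R t) by apply: prod_act_closed.
by have /(congr1 (@^~ x)) := G_comm _ _ Gg Gt.
Qed.

(** The orbit of [y] returns to [y] at all natural multiples of [d], so in characteristic zero [b]
    is constant along it. *)
Lemma gen_fixpoint (rho : gact X) d y b :
  d != 0 -> rho d y = y -> gen rho b y = 0.
Proof.
move=> d0 dy; apply: (mulfI d0); rewrite mulr0.
have := gen_scale k_char0 d rho b; move=> /(congr1 (fun a => pf_fun a y)).
rewrite pfME cstE => <-; rewrite genE.
suff -> : orb (gact_scale d rho) b y = (b y)%:P by rewrite coefC.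
apply: (poly_eq_nat k_char0) => j; rewrite hornerC -orbE /=; congr (b _).
elim: j => [|j IH]; first by rewrite mulr0 gact0.
by rewrite -natr1 mulrDr mulr1 gactD dy.
Qed.

Lemma replica_cent (U : set (X -> X)) (rho : gact X) a :
  commutative_set U -> one_param U rho -> invariant U a ->
  cent U (fun x => rho (a x) x).
Proof.
move=> U_comm rhoU ia.
have mor (b : polyfun X) : morphism (fun x => rho (b x) x).
  apply/morphismP => i; apply: (polynomial_comp (g := fun x => (b x, x))
    (gact_polynomial rho i)) => e.
  rewrite -(splitK e); case: (split e) => j /=.
    by apply: polynomial_ext (pf_polynomial b) => x; rewrite act_pt_l.
  by apply: polynomial_ext (polynomial_coord pt j) => x; rewrite act_pt_r.
split=> [|b ib x|u Uu x].
- split; first exact: mor.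
  exists (fun x => rho ((- a) x) x); split; first exact: mor.
    by move=> x /=; rewrite (ia _ (rhoU _)) gactNK.
  by move=> x /=; rewrite (ia _ (rhoU _)) gactK.
- exact: ib.
- by rewrite ia //; have /(congr1 (@^~ x)) := U_comm _ _ (rhoU (a x)) Uu.
Qed.

(** Commuting with [rho] and with its replica by [a] shows that [rho] fixes [h y] at time
    [a (h y) - a y]. Where this time is nonzero, [gen rho b] vanishes at [h y]. So the product of
    [pull h a - a] and [pull h (gen rho b)] is zero, and the second factor is not. *)
Lemma centralizer_cent (U : set (X -> X)) h : unipotent_subgroup U ->
  commutative_set U -> cent U <> [set id]%classic -> Aut h ->
  (forall g, cent U g -> forall x, h (g x) = g (h x)) -> cent U h.
Proof.
move=> U_unip U_comm cU hA hc; have [mh [h' [mh' hh' h'h]]] := hA.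
split=> //; last by move=> u Uu x; apply: hc; apply: cent_contains.
(* If [U] were trivial, all regular functions would be invariant and [cent U] would be trivial
   too. *)
have [u Uu u1] : exists2 u, U u & u <> id.
  apply: contrapT => nU; apply: cU; apply/seteqP; split=> g.
    move=> [_ gi _]; apply/funext => x; apply: pt_inj => i.
    rewrite -!coordE; apply: gi => v Uv y.
    have [->//|v1] := pselect (v = id); by case: nU; exists v.
  by move=> ->; have [_ ? _ _] := @cent_aut_subgroup k n X U.
have [rho rho1 rhoU] := one_param_exists k_char0 U_unip Uu.
have [b b0] : exists b, gen rho b != 0.
  apply: contrapT => nb; apply: u1; rewrite -rho1; apply/funext => x.
  apply: pt_inj => i; rewrite -!coordE; apply: (proj1 (gen_eq0 k_char0 rho _)).
  by apply/eqP/negPn/negP => gi; apply: nb; exists (coord i).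
move=> a ia x; rewrite -(pullE _ _ mh); congr (pf_fun _ x).
apply/eqP; rewrite -subr_eq0; apply/eqP.
(* Pulling back along the surjective map [h] preserves nonvanishing. *)
have hb0 : pull h (gen rho b) != 0.
  have [y by0] := polyfun_neq0 b0; apply: contraNneq by0.
  by move=> /(congr1 (fun a => pf_fun a (h' y))); rewrite pullE // h'h => ->.
apply: (cancel_nonzero (polyfun_integral X_irr) hb0); apply: polyfunP => y.
rewrite !pfE !pullE //; apply/eqP; rewrite mulf_eq0 orbC.
case: eqVneq => //= d0; apply/eqP; apply: (gen_fixpoint _ d0).
have := hc _ (replica_cent U_comm rhoU ia) y.
rewrite hc; last by apply: cent_contains => //; apply: rhoU.
by rewrite addrC gactD => <-; rewrite -gactD addNr gact0.
Qed.

End Maximality.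

(** The trivial group satisfies (c) with [U] trivial, but it need not be maximal, for instance on
    the affine line; this is what [G_nontrivial] excludes. *)
Theorem theorem1 (k : closedFieldType) (k_char0 : [pchar k]%R =i pred0)
    (n : nat) (X : set 'rV[k]_n) (X_closed : zclosed X)
    (X_irreducible : irreducible X)
    (G : set (X -> X)) (G_unipotent : unipotent_subgroup G)
    (G_commutative : commutative_set G) (G_nontrivial : G <> [set id]%classic) :
  [<-> (* (a) *)
       maximal_among
         [set H | aut_subgroup H /\ commutative_set H]%classic G;
       (* (b) *)
       maximal_among
         [set H | unipotent_subgroup H /\ commutative_set H]%classic G;
       (* (c) *)
       exists U : set (X -> X),
         [/\ alg_subgroup U, unipotent_subgroup U, commutative_set U &
             G = RX U] ].
Proof.
split=> [[_ G_max]|].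
  split=> [//|H [[H_group _ _] H_comm] GH].
  by apply: G_max => //; split.
split; first exact: maximal_unipotent_is_RX.
move=> [U [_ U_unip U_comm GE]]; have [G_group _ _] := G_unipotent.
rewrite (RX_eq_cent k_char0 X_closed X_irreducible U_unip U_comm) in GE.
split=> [//|H [[HA _ _ _] H_comm] GH]; apply/seteqP; split=> // h Hh.
rewrite GE; apply: (centralizer_cent k_char0) => //; rewrite -?GE //.
  exact: HA.
move=> g /GH Hg x.
by have /(congr1 (@^~ x)) := H_comm _ _ Hh Hg.
Qed.
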